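(* Let $(W,S)$ be a Coxeter system with Coxeter graph $\Gamma$ such that $W$ is infinite and irreducible (possibly of infinite rank), and let $\tau\in\mathrm{Aut}\,\Gamma$. Let $\tau\backslash S$ be the set of $\langle\tau\rangle$-orbits in $S$. (1) If $|W_I|<\infty$ for all $I\in\tau\backslash S$, then the Coxeter group $W^\tau$ is also infinite and irreducible with respect to the generating set $S(W^\tau)$. (2) Suppose that the hypothesis of (1) fails (i.e. $|W_I|=\infty$ for some $I\in\tau\backslash S$) and every orbit $I\in\tau\backslash S$ is finite. Then for any $1\neq w\in W^\tau$, there is an element $u\in W$ of infinite order such that $u^kw\tau(u)^{-k}\neq w$ for all $0\neq k\in\mathbb{Z}$.
   Context: For a Coxeter system $(W,S)$ with $m_{s,t}$ the order of $st$, the Coxeter graph $\Gamma$ has vertex set $S$, with $s,t$ joined by an edge labelled $m_{s,t}$ iff $m_{s,t}\ge 3$ (possibly $\infty$). $W$ is irreducible if $\Gamma$ is connected. $\mathrm{Aut}\,\Gamma$ is the group of label-preserving graph automorphisms; each $\tau\in\mathrm{Aut}\,\Gamma$ extends uniquely to a group automorphism of $W$, also denoted $\tau$. For $I\subseteq S$, $W_I=\langle I\rangle$; if $W_I$ is finite, $w_0(I)$ is its longest element. $W^\tau=\{w\in W\mid\tau(w)=w\}$. By a theorem of Steinberg, $W^\tau$ is a Coxeter group with respect to the generating set $$S(W^\tau)=\{w_0(I)\mid I\in\tau\backslash S,\ |W_I|<\infty\}.$$ *)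

(* Defs.v *)
From Stdlib Require Import Relation_Operators.
From mathcomp Require Import all_boot all_algebra.
From mathcomp Require Import mathcomp_extra boolp classical_sets functions cardinality.

Set Implicit Arguments.
Unset Strict Implicit.
Unset Printing Implicit Defensive.

Local Open Scope classical_set_scope.
Local Open Scope group_scope.

(* Least element of P, with value 0 when P is empty. *)
Definition min_nat (P : set nat) : nat :=
  if pselect (exists n, (fun m => `[< P m >]) n) is left h then ex_minn h else 0%N.

Section Groups.
Variable W : groupType.
Implicit Types (A S I : set W) (x : W) (l : seq W).

(* The value 0 stands for infinite order. *)
Definition gorder x : nat := min_nat [set n | (0 < n)%N /\ x ^+ n = 1].

Definition expgz x (k : int) : W :=
  match k with
  | Posz n => x ^+ n
  | Negz n => x ^- n.+1
  end.

Definition subgroup_gen A : set W :=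
  smallest [set H : set W | H 1 /\ forall x y, H x -> H y -> H (x / y)] A.

Definition prodw l : W := \prod_(x <- l) x.

(* Defining relators (st)^m(s,t).  For s = t this gives s s = 1, so words in S
   need no inverses; m(s,t) = 0, i.e. infinity, gives no relation. *)
Inductive coxeter_step S : seq W -> seq W -> Prop :=
| CoxeterStep (u v : seq W) (s t : W) : s \in S -> t \in S ->
    coxeter_step S
      (u ++ flatten (nseq (gorder (s * t)) [:: s; t]) ++ v) (u ++ v).

(* W = < S | (st)^m(s,t) = 1 >, with m(s,t) the order of st in W: the last
   clause says that every relation between the generators is a consequence of
   the defining ones. *)
Definition coxeter_system S : Prop :=
  [/\ forall s, s \in S -> gorder s = 2%N,
      subgroup_gen S = setT
    & forall l, {subset l <= S} -> prodw l = 1 ->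
        clos_refl_sym_trans (seq W) (coxeter_step S) l [::]].

Definition coxeter_edge S : rel W := fun s t =>
  [&& s \in S, t \in S & (gorder (s * t) == 0%N) || (3 <= gorder (s * t))%N].

(* Connectedness of the Coxeter graph on the vertex set S. *)
Definition coxeter_irreducible S : Prop :=
  forall s t, s \in S -> t \in S ->
    exists p : seq W, path (coxeter_edge S) s p /\ last s p = t.

(* Only the values of tau on S are relevant. *)
Definition coxeter_graph_aut S (tau : W -> W) : Prop :=
  [/\ set_bij S S tau,
      {in S &, forall s t, coxeter_edge S (tau s) (tau t) = coxeter_edge S s t}
    & {in S &, forall s t, coxeter_edge S s t ->
        gorder (tau s * tau t) = gorder (s * t)}].

Definition group_aut (f : W -> W) : Prop :=
  bijective f /\ {morph f : x y / x * y}.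

Definition orbit_of S (tau : W -> W) (s : W) : set W :=
  [set t | S t /\ exists k : nat, t = iter k tau s \/ s = iter k tau t].

Definition orbits S (tau : W -> W) : set (set W) :=
  [set orbit_of S tau s | s in S].

Definition coxeter_length S (w : W) : nat :=
  min_nat [set n | exists l, [/\ {subset l <= S}, prodw l = w & size l = n]].

Definition longest S I : W :=
  xget 1 [set w | subgroup_gen I w /\
    forall v, subgroup_gen I v ->
      (coxeter_length S v <= coxeter_length S w)%N].

Definition fixed_points (f : W -> W) : set W := [set w | f w = w].

(* Steinberg's generators of the subgroup fixed by the automorphism tau. *)
Definition fixed_gens S (tau : W -> W) : set W :=
  [set longest S I | I in
     [set I | orbits S tau I /\ finite_set (subgroup_gen I)]].

End Groups.

(* Main.v *)
(** Everything is done in the geometric representation of [W].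

    (1) A fixed element [w] of maximal length has all of [S] as descents: if [s] were not
    a descent, neither would be any element of its orbit [I], and [w * w0(I)] would be a
    longer fixed element. Then every positive root is an inversion of [w], so [W] would be
    finite. For irreducibility, [w0(I)] and [w0(J)] do not commute when [I] and [J] are
    distinct orbits joined by an edge.

    (2) Suppose that every [u] has a power with [w^-1 u^n w = tau(u)^n]. As [w <> 1] is
    fixed and [W_I] is infinite for some orbit [I], [w] is not in [W_I]; let [p] be a letter
    of [w^-1] outside [I]. Grow a connected subset of [I] of infinite type along a path to a
    finite connected [J] not containing but adjacent to [p]. By Ramsey's theorem [W_J] has
    two reflections with roots [a], [b] such that [|(a, b)| >= 2] (the norm of roots being
    [(a, a) = 2]). Applying the assumption to the [W_J]-conjugates of their product gives
    [w^-1 V_J = V_(tau J)] for the spans of simple roots. A descent of [w^-1] outside [J]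
    but not orthogonal to [J] would then give infinitely many inversions, so every letter
    of [w^-1] is in [J] or orthogonal to [J], contradicting the choice of [p]. *)

Require Import Defs.
From Stdlib Require Import Relation_Operators.
From mathcomp Require Import all_boot all_order all_algebra.
From mathcomp Require Import boolp classical_sets functions cardinality.
From mathcomp Require Import reals trigo ring lra zify.
From mathcomp Require Rstruct.

Set Implicit Arguments.
Unset Strict Implicit.
Unset Printing Implicit Defensive.

Import Order.TTheory GRing.Theory Num.Theory.

Local Open Scope classical_set_scope.
Local Open Scope ring_scope.


(** * Chebyshev polynomials at [2 cos (pi / m)] *)

(** The rank may be infinite, so a bilinear form and a height are available only over a finite [J];
    this is where the finiteness of the orbits enters in (2).

    Ramsey's theorem needs finitely many colours, that is, finitely many values of [(a, b)] with
    [|(a, b)| < 2]. Two such roots generate a finite dihedral group, and averaging the height over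
    it gives a functional that vanishes on [a] and [b] and is positive on all but finitely many
    positive roots. Conjugating the functional into the dominant chamber moves [a] and [b] into a
    standard parabolic subsystem with finitely many roots, and a finite [J] has only finitely many
    of these.

    The bound 2 is also what makes powers harmless. With [c = (a, b)] and [u] the product of the two
    reflections, the vectors [u^i a] satisfy a recurrence with trace [c^2 - 2 >= 2], whose periodic
    scalar solutions are constant or zero. Hence knowing that some unknown power of [u] is
    conjugated into a parabolic subgroup is already enough. *)

Section Chebyshev.
Variable R : realType.
Implicit Types (a : R) (m j : nat).

(** Chebyshev polynomials of the second kind, indexed so that [chebU (2 * cos t) j] is
    [sin (j t) / sin t]. They are the coefficients of roots in a dihedral subsystem. *)
Definition chebU a j : R := (iter j (fun p => (p.2, a * p.2 - p.1)) (0, 1)).1.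

(** The label 0 encodes infinity, and 2 is the limit of [2 * cos (pi / m)]. *)
Definition twocos m : R := if m == 0%N then 2 else 2 * cos (pi / m%:R).

Lemma chebU0 a : chebU a 0 = 0. Proof. by []. Qed.

Lemma chebU1 a : chebU a 1 = 1. Proof. by []. Qed.

Lemma chebUSS a j : chebU a j.+2 = a * chebU a j.+1 - chebU a j.
Proof. by []. Qed.

Lemma chebU_two j : chebU 2 j = j%:R.
Proof.
suff: chebU 2 j = j%:R /\ chebU 2 j.+1 = j.+1%:R by case.
elim: j => [|j [IH1 IH2]]; first by rewrite chebU0 chebU1.
by split=> //; rewrite chebUSS IH1 IH2 -!natr1; lra.
Qed.

Lemma sin_chebU (t : R) j :
  sin t * chebU (2 * cos t) j = sin (j%:R * t).
Proof.
suff: sin t * chebU (2 * cos t) j = sin (j%:R * t) /\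
      sin t * chebU (2 * cos t) j.+1 = sin (j.+1%:R * t) by case.
elim: j => [|j [IH1 IH2]].
  by rewrite chebU0 chebU1 mul0r sin0 mulr0 mulr1 mul1r.
split=> //; rewrite chebUSS.
have -> : sin t * (2 * cos t * chebU (2 * cos t) j.+1 - chebU (2 * cos t) j) =
  2 * cos t * (sin t * chebU (2 * cos t) j.+1) - sin t * chebU (2 * cos t) j.
  by ring.
rewrite IH1 IH2.
have -> : j.+2%:R * t = j.+1%:R * t + t by rewrite -[j.+2%:R]natr1; ring.
have -> : j%:R * t = j.+1%:R * t - t by rewrite -[j.+1%:R]natr1; ring.
by rewrite sinB sinD; ring.
Qed.

Lemma sin_pi_div_gt0 m : (1 < m)%N -> 0 < sin (pi / m%:R) :> R.
Proof.
move=> m1; apply: sin_gt0_pi; apply/andP; split.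
  by rewrite divr_gt0 ?pi_gt0 // ltr0n (ltn_trans _ m1).
by rewrite ltr_pdivrMr ?ltr0n ?(ltn_trans _ m1)// ltr_pMr ?pi_gt0 // ltr1n.
Qed.

(** [sin (j pi / m)] stays nonnegative up to [j = m]; [m = 1] is excluded because there the
    denominator [sin pi] is 0. *)
Lemma chebU_twocos_ge0 m j :
  m != 1%N -> (m == 0%N) || (j <= m)%N -> 0 <= chebU (twocos m) j.
Proof.
rewrite /twocos; have [->|m0] /= := eqVneq m 0%N; first by rewrite chebU_two.
move=> m1 jm; have m2 : (1 < m)%N by lia.
have s0 := sin_pi_div_gt0 m2.
rewrite -(pmulr_rge0 _ s0) sin_chebU; apply: sin_ge0_pi.
have mR : 0 < m%:R :> R by rewrite ltr0n; lia.
rewrite mulr_ge0 ?divr_ge0 ?ler0n ?pi_ge0 //=.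
by rewrite mulrCA ler_piMr ?pi_ge0// ler_pdivrMr// mul1r ler_nat.
Qed.

(** The angle [2 m * pi / m] is a full turn; this is what makes [(st)^m] trivial on the plane of [s]
    and [t]. *)
Lemma chebU_double m : (1 < m)%N ->
  chebU (twocos m) m.*2 = 0 /\ chebU (twocos m) m.*2.+1 = 1.
Proof.
move=> m1; rewrite /twocos; have -> : (m == 0%N) = false by lia.
have s0 := sin_pi_div_gt0 m1.
have mR : m%:R != 0 :> R by rewrite pnatr_eq0; lia.
have e : m.*2%:R * (pi / m%:R) = pi *+ 2 :> R.
  by rewrite -muln2 natrM mulr2n; field.
split; apply: (mulfI (lt0r_neq0 s0)); rewrite sin_chebU.
  by rewrite e sin2pi mulr0.
by rewrite -natr1 mulrDl e mul1r addrC sinD2pi mulr1.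
Qed.

Lemma twocos1 : twocos 1 = - 2.
Proof. by rewrite /twocos /= divr1 cospi; lra. Qed.

Lemma twocos2 : twocos 2 = 0.
Proof. by rewrite /twocos /= cos_pihalf mulr0. Qed.

Lemma twocos_gt0 m : (m == 0%N) || (2 < m)%N -> 0 < twocos m.
Proof.
rewrite /twocos; have [_ _|m0 /= m2] := eqVneq m 0%N; first by [].
have mR : 0 < m%:R :> R by rewrite ltr0n; lia.
rewrite mulr_gt0// cos_gt0_pihalf//; apply/andP; split.
  by apply: (@lt_trans _ _ 0); rewrite ?oppr_lt0 divr_gt0 ?pi_gt0.
rewrite ltr_pM2l ?pi_gt0// ltf_pV2 ?posrE ?ltr0n//; last by lia.
by rewrite ltr_nat.
Qed.

Lemma twocos_lt2 m : (0 < m)%N -> twocos m < 2.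
Proof.
move=> m0; rewrite /twocos; have -> : (m == 0%N) = false by lia.
have mR : 0 < m%:R :> R by rewrite ltr0n; lia.
suff : cos (pi / m%:R) < cos 0 :> R by rewrite cos0; lra.
rewrite ltr_cos ?divr_gt0 ?pi_gt0//.
  by rewrite in_itv /= lexx pi_ge0.
rewrite in_itv /= divr_ge0 ?pi_ge0 ?(ltW mR)//=.
by rewrite ger_pMr ?pi_gt0// invf_le1// ler1n.
Qed.

End Chebyshev.


(** * Words and the geometric representation *)

Section Words.
Variable W : groupType.
Implicit Types (A S : set W) (s t x y w : W) (l : seq W).

Lemma min_natP (P : set nat) : (exists n, P n) ->
  P (min_nat P) /\ forall n, P n -> (min_nat P <= n)%N.
Proof.
move=> exP; rewrite /min_nat; case: pselect => [h|nh].
  case: ex_minnP => n /asboolP Pn minn; split=> // k Pk.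
  by apply: minn; apply/asboolP.
by case: nh; case: exP => n Pn; exists n; apply/asboolP.
Qed.

Lemma gorder_le x n : (0 < n)%N -> (x ^+ n = 1)%g -> (0 < gorder x <= n)%N.
Proof.
move=> n0 xn; have [|[h _] h'] := @min_natP [set n | (0 < n)%N /\ (x ^+ n = 1)%g].
  by exists n.
by rewrite /gorder h h'.
Qed.

Lemma expg_gorder x : (x ^+ gorder x = 1)%g.
Proof.
have [[n [n0 xn]]|nex] := pselect (exists n, (0 < n)%N /\ (x ^+ n = 1)%g).
  have [|[]//] := @min_natP [set n | (0 < n)%N /\ (x ^+ n = 1)%g].
  by exists n.
rewrite /gorder /min_nat; case: pselect => [h|//].
by case: nex; case: h => n /asboolP h; exists n.
Qed.

Lemma gorder_eq x y : (forall n, (x ^+ n = 1)%g <-> (y ^+ n = 1)%g) ->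
  gorder x = gorder y.
Proof.
move=> h; rewrite /gorder; congr min_nat; apply/seteqP.
by split=> n /= [n0 /h].
Qed.

Lemma gorder1 : gorder (1 : W)%g = 1%N.
Proof. by have := @gorder_le 1%g 1%N isT (expg1 _); case: gorder => [|[]]. Qed.

Lemma gorder_eq1 x : gorder x = 1%N -> x = 1%g.
Proof. by move=> h; have := expg_gorder x; rewrite h expg1. Qed.

Lemma gorderV x : gorder (x^-1)%g = gorder x.
Proof.
apply: gorder_eq => n; rewrite expVgn; split=> [h|->]; last by rewrite invg1.
by rewrite -[(x ^+ n)%g]invgK h invg1.
Qed.

Lemma conj_expg x y n : ((x * y * x^-1) ^+ n = x * y ^+ n * x^-1)%g.
Proof.
elim: n => [|n IH]; first by rewrite !expg0 mulg1 mulgV.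
by rewrite !expgS IH !mulgA mulgVK.
Qed.

Lemma prodw_nil : prodw [::] = 1%g :> W.
Proof. by rewrite /prodw big_nil. Qed.

Lemma prodw_cons s l : prodw (s :: l) = (s * prodw l)%g.
Proof. by rewrite /prodw big_cons. Qed.

Lemma prodw_cat l l' : prodw (l ++ l') = (prodw l * prodw l')%g.
Proof. by rewrite /prodw big_cat. Qed.

Lemma prodw1 s : prodw [:: s] = s.
Proof. by rewrite prodw_cons prodw_nil mulg1. Qed.

Lemma prodw_rcons l s : prodw (rcons l s) = (prodw l * s)%g.
Proof. by rewrite -cats1 prodw_cat prodw1. Qed.

Definition involutive_set A := forall s, s \in A -> (s * s = 1)%g.

Lemma invg_involution A s : involutive_set A -> s \in A -> (s^-1 = s)%g.
Proof. by move=> hA /hA; apply: mulg1_eq. Qed.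

Lemma words_seq1 A s : s \in A -> {subset [:: s] <= A}.
Proof. by move=> sA z; rewrite mem_seq1 => /eqP ->. Qed.

Lemma words_cat A l l' : {subset l <= A} -> {subset l' <= A} -> {subset l ++ l' <= A}.
Proof. by move=> lA lA' z; rewrite mem_cat => /orP[/lA|/lA']. Qed.

Lemma words_rev A l : {subset l <= A} -> {subset rev l <= A}.
Proof. by move=> lA z; rewrite mem_rev => /lA. Qed.

Lemma words_cons A s l : {subset s :: l <= A} -> s \in A /\ {subset l <= A}.
Proof.
move=> h; split; first by apply: h; rewrite mem_head.
by move=> z zl; apply: h; rewrite in_cons zl orbT.
Qed.

Lemma words_rcons A s l : {subset rcons l s <= A} -> {subset l <= A} /\ s \in A.
Proof.
move=> h; split; first by move=> z zl; apply: h; rewrite mem_rcons in_cons zl orbT.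
by apply: h; rewrite mem_rcons mem_head.
Qed.

Lemma prodw_rev A l : involutive_set A -> {subset l <= A} ->
  prodw (rev l) = (prodw l)^-1%g.
Proof.
move=> hA; elim: l => [_|s l IH /words_cons[sA lA]]; first by rewrite prodw_nil invg1.
rewrite rev_cons prodw_rcons prodw_cons invgM (@invg_involution _ s hA)//.
by rewrite IH.
Qed.

(** Words without inverses: for a set of involutions this is the generated subgroup
    ([subgroup_genE]), in a form suited to induction on words. *)
Definition gen_words A : set W := [set w | exists2 l, {subset l <= A} & prodw l = w].

Lemma gen_words1 A : gen_words A 1%g.
Proof. by exists [::]; rewrite ?prodw_nil. Qed.

Lemma gen_wordsM A x y : gen_words A x -> gen_words A y -> gen_words A (x * y)%g.
Proof.
move=> [l lA <-] [l' lA' <-]; exists (l ++ l'); last exact: prodw_cat.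
exact: words_cat.
Qed.

Lemma gen_wordsV A x : involutive_set A -> gen_words A x -> gen_words A (x^-1)%g.
Proof.
move=> hA [l lA <-]; exists (rev l); last exact: (prodw_rev hA).
exact: words_rev.
Qed.

Lemma gen_words_gen A s : s \in A -> gen_words A s.
Proof. by move=> sA; exists [:: s]; rewrite ?prodw1//; apply: words_seq1. Qed.

Lemma gen_wordsS A B x : A `<=` B -> gen_words A x -> gen_words B x.
Proof. by move=> AB [l lA <-]; exists l => // z /lA /set_mem /AB /mem_set. Qed.

Lemma subgroup_genE A : involutive_set A -> subgroup_gen A = gen_words A.
Proof.
move=> hA; apply/seteqP; split.
  move=> x; apply; split.
    split; first exact: gen_words1.
    by move=> y z Ay Az; apply: gen_wordsM => //; apply: gen_wordsV.
  by move=> y /mem_set; apply: gen_words_gen.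
move=> _ [l lA <-] H [[H1 HM] AH].
have HV y : H y -> H (y^-1)%g by move=> Hy; rewrite -div1g; apply: HM.
elim: l lA => [|s l IH]; first by rewrite prodw_nil.
move=> /words_cons[sA lA]; rewrite prodw_cons -[prodw l]invgK.
by apply: HM; [apply/AH/set_mem | apply/HV/IH].
Qed.

End Words.

(** * Length function and parity *)

Section Length.
Variables (W : groupType) (S : set W) (hWS : coxeter_system S).
Implicit Types (s t x y w : W) (l : seq W).
Let len := coxeter_length S.

Lemma coxeter_invol : involutive_set S.
Proof. by case: hWS => h _ _ s /h e; rewrite -expg2 -e expg_gorder. Qed.

Lemma coxeter_words w : gen_words S w.
Proof.
have -> : gen_words S = setT; last by [].
by case: hWS => _ <- _; rewrite (subgroup_genE coxeter_invol).
Qed.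

(** Every relator [(st)^m] has even length [2 m], so a rewriting step preserves parity. *)
Lemma parity_words l l' : {subset l <= S} -> {subset l' <= S} ->
  prodw l = prodw l' -> odd (size l) = odd (size l').
Proof.
move=> lS lS' e; case: hWS => _ _ /(_ (l ++ rev l')).
have step a b : clos_refl_sym_trans (seq W) (coxeter_step S) a b ->
    odd (size a) = odd (size b).
  elim=> {a b} [_ _ [a b s t _ _]|//|a b _ ->//|a b c _ -> _ ->//].
  rewrite !size_cat size_flatten /shape map_nseq sumn_nseq.
  by rewrite !oddD; case: (odd (gorder _)).
move=> h; have /h h' : {subset l ++ rev l' <= S}.
  by apply: words_cat => //; apply: words_rev.
have /h'/step : prodw (l ++ rev l') = 1%g.
  by rewrite prodw_cat (prodw_rev coxeter_invol)// e mulgV.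
by rewrite size_cat size_rev oddD /=; do 2 case: odd.
Qed.

Definition red_word w : seq W :=
  xget [::] [set l : seq W | [/\ {subset l <= S}, prodw l = w & size l = len w]].

Lemma red_wordP w :
  [/\ {subset red_word w <= S}, prodw (red_word w) = w & size (red_word w) = len w].
Proof.
rewrite /red_word; case: xgetP => [l _ []//|no].
have [|[l [lS lw le]] _] := @min_natP
    [set n | exists l, [/\ {subset l <= S}, prodw l = w & size l = n]].
  by have [l lS lw] := coxeter_words w; exists (size l), l.
by case: (no l).
Qed.

Lemma len_le l : {subset l <= S} -> (len (prodw l) <= size l)%N.
Proof.
move=> lS; have [|_] := @min_natP
    [set n | exists l', [/\ {subset l' <= S}, prodw l' = prodw l & size l' = n]].
  by exists (size l), l.
by apply; exists l.
Qed.

(** The length changes by at most one, and parity excludes equality. *)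
Lemma len_prod_gen w s : s \in S ->
  len (w * s)%g = (len w).+1 \/ len w = (len (w * s)%g).+1.
Proof.
move=> sS.
have [l1 w1 z1] := red_wordP w; have [l2 w2 z2] := red_wordP (w * s)%g.
have sub l : {subset l <= S} -> {subset rcons l s <= S}.
  by rewrite -cats1 => lS; apply: words_cat => //; apply: words_seq1.
have e1 : prodw (rcons (red_word w) s) = prodw (red_word (w * s)%g).
  by rewrite prodw_rcons w1 w2.
have := parity_words (sub _ l1) l2 e1; rewrite size_rcons z1 z2.
have := len_le (sub _ l1); rewrite size_rcons z1 e1 w2.
have := len_le (sub _ l2); rewrite size_rcons z2 prodw_rcons w2 -mulgA coxeter_invol// mulg1.
rewrite -/len /=; lia.
Qed.

Lemma len_eq0 w : len w = 0%N -> w = 1%g.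
Proof.
move=> h; have [_ lw lz] := red_wordP w.
by rewrite -lw; move: lz; rewrite h => /size0nil ->; rewrite prodw_nil.
Qed.

Lemma len1 : len 1%g = 0%N.
Proof. by apply/eqP; rewrite -leqn0 -[X in len X]prodw_nil len_le. Qed.

Lemma lenV w : len (w^-1)%g = len w.
Proof.
suff h v : (len (v^-1)%g <= len v)%N.
  by apply/eqP; rewrite eqn_leq h -[X in (len X <= _)%N]invgK h.
have [lS lw lz] := red_wordP v.
rewrite -lz -{1}lw -(prodw_rev coxeter_invol lS) -(size_rev (red_word v)); apply: len_le.
exact: words_rev.
Qed.

Lemma len_descent w : w <> 1%g -> exists2 s, s \in S & len w = (len (w * s)%g).+1.
Proof.
move=> w1; have [lS lw lz] := red_wordP w.
case/lastP: (red_word w) lS lw lz => [|l s] lS lw lz.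
  by case: w1; rewrite -lw prodw_nil.
have [lS' sS] := words_rcons lS.
exists s => //; case: (len_prod_gen w sS) => // e.
have : (len (prodw l) <= size l)%N.
  exact: len_le.
have -> : prodw l = (w * s)%g.
  by rewrite -lw prodw_rcons -mulgA coxeter_invol// mulg1.
by rewrite e; move: lz; rewrite size_rcons; lia.
Qed.

End Length.

(** * The geometric representation *)

Section Geometric.
Variables (R : realType) (W : groupType) (S : set W) (hWS : coxeter_system S).
Implicit Types (s t w : W) (l : seq W).
Local Notation V := (W * bool -> R^o).
Implicit Types (x y : V).

(* A vector carries its coordinates [cf x t] in the simple roots together with its products
   [pr x t] with them, so that reflections are defined without finiteness assumptions on
   supports; [pr] is determined by [cf] on the span of the simple roots only. *)
Definition cf x t : R := x (t, false).
Definition pr x t : R := x (t, true).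

Lemma cfD x y t : cf (x + y) t = cf x t + cf y t. Proof. by []. Qed.
Lemma cfN x t : cf (- x) t = - cf x t. Proof. by []. Qed.
Lemma cfB x y t : cf (x - y) t = cf x t - cf y t. Proof. by []. Qed.
Lemma cfZ a x t : cf (a *: x) t = a * cf x t. Proof. by []. Qed.
Lemma cf0 t : cf 0 t = 0. Proof. by []. Qed.
Lemma prD x y t : pr (x + y) t = pr x t + pr y t. Proof. by []. Qed.
Lemma prN x t : pr (- x) t = - pr x t. Proof. by []. Qed.
Lemma prB x y t : pr (x - y) t = pr x t - pr y t. Proof. by []. Qed.
Lemma prZ a x t : pr (a *: x) t = a * pr x t. Proof. by []. Qed.
Lemma pr0 t : pr 0 t = 0. Proof. by []. Qed.
Definition cfE := (cfD, cfN, cfB, cfZ, cf0).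
Definition prE := (prD, prN, prB, prZ, pr0).

(* [2 * B(s, t)] in the usual normalisation, with [2 * B = -2] for an infinite label; on the
   diagonal the label is 1 and [- twocos 1 = 2]. *)
Definition cartan s t : R := - twocos R (gorder (s * t)%g).

Definition sroot s : V := fun p => if p.2 then cartan s p.1 else (p.1 == s)%:R.

Lemma cf_sroot s t : cf (sroot s) t = (t == s)%:R. Proof. by []. Qed.
Lemma pr_sroot s t : pr (sroot s) t = cartan s t. Proof. by []. Qed.

Lemma cartan_diag s : s \in S -> cartan s s = 2.
Proof.
by move=> sS; rewrite /cartan (coxeter_invol hWS)// gorder1 twocos1 opprK.
Qed.

Lemma cartan_sym s t : s \in S -> t \in S -> cartan s t = cartan t s.
Proof.
move=> sS tS; rewrite /cartan -gorderV invgM.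
by rewrite !(invg_involution (coxeter_invol hWS)).
Qed.

Lemma gorder_neq1 s t : s \in S -> t \in S -> s != t -> gorder (s * t)%g != 1%N.
Proof.
move=> sS tS; apply: contra_neq => /gorder_eq1 /mulg1_eq <-.
by rewrite (invg_involution (coxeter_invol hWS)).
Qed.

Lemma cartan_le0 s t : s \in S -> t \in S -> s != t -> cartan s t <= 0.
Proof.
move=> sS tS st; rewrite /cartan oppr_le0.
have := gorder_neq1 sS tS st; case: gorder => [|[|[|n]]]// _.
  by rewrite twocos2.
by rewrite ltW// twocos_gt0.
Qed.

Lemma cartan_edge s t : coxeter_edge S s t -> cartan s t < 0.
Proof.
move=> /and3P[sS tS h]; rewrite oppr_lt0 twocos_gt0//.
Qed.

Lemma cartan_lt0_edge s t : s \in S -> t \in S -> cartan s t < 0 ->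
  coxeter_edge S s t.
Proof.
move=> sS tS; rewrite /coxeter_edge sS tS oppr_lt0 /=.
case: gorder => [|[|[|n]]]//; first by rewrite twocos1 ltrNr oppr0 ltrn0.
by rewrite twocos2 ltxx.
Qed.

Definition refl s x : V := x - pr x s *: sroot s.

Lemma cf_refl s x t : t != s -> cf (refl s x) t = cf x t.
Proof. by move=> /negPf ts; rewrite /refl !cfE cf_sroot ts mulr0 subr0. Qed.

Lemma reflD s x y : refl s (x + y) = refl s x + refl s y.
Proof. by rewrite /refl prD scalerDl opprD addrACA. Qed.

Lemma reflZ s a x : refl s (a *: x) = a *: refl s x.
Proof. by rewrite /refl prZ scalerBr scalerA. Qed.

Lemma refl_sroot s : s \in S -> refl s (sroot s) = - sroot s.
Proof.
move=> sS; rewrite /refl pr_sroot cartan_diag//.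
by rewrite -[X in X - _]scale1r -scalerBl -[RHS]scaleN1r; congr (_ *: _); lra.
Qed.

Lemma reflK s x : s \in S -> refl s (refl s x) = x.
Proof.
move=> sS; rewrite {1}/refl {2}/refl !prE pr_sroot cartan_diag// /refl.
have -> : pr x s - pr x s * 2 = - pr x s by lra.
by rewrite scaleNr opprK subrK.
Qed.

Definition act l x : V := foldr refl x l.

Lemma act_cat l l' x : act (l ++ l') x = act l (act l' x).
Proof. exact: foldr_cat. Qed.

Lemma act_rcons l s x : act (rcons l s) x = act l (refl s x).
Proof. by rewrite -cats1 act_cat. Qed.

Lemma actD l x y : act l (x + y) = act l x + act l y.
Proof. by elim: l => //= s l ->; rewrite reflD. Qed.

Lemma actZ l a x : act l (a *: x) = a *: act l x.
Proof. by elim: l => //= s l ->; rewrite reflZ. Qed.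

Lemma act_revK l x : {subset l <= S} -> act (rev l) (act l x) = x.
Proof.
elim: l => //= s l IH /words_cons[sS lS].
by rewrite rev_cons act_rcons reflK//; apply: IH.
Qed.

Lemma act_flatten_nseq n l x : act (flatten (nseq n l)) x = iter n (act l) x.
Proof. by elim: n => //= n IH; rewrite act_cat IH. Qed.

Lemma iter_dihedral s t j : s \in S -> t \in S -> let c := - cartan s t in
  iter j (act [:: s; t]) (sroot s) =
    chebU c j.*2.+1 *: sroot s + chebU c j.*2 *: sroot t /\
  iter j (act [:: s; t]) (sroot t) =
    - chebU c j.*2 *: sroot s +
    (chebU c j.*2.+1 - c * chebU c j.*2) *: sroot t.
Proof.
move=> sS tS c.
have cst : cartan s t = - c by rewrite opprK.
have cts : cartan t s = - c by rewrite cartan_sym.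
have us a b : act [:: s; t] (a *: sroot s + b *: sroot t) =
    ((c * c - 1) * a - c * b) *: sroot s + (c * a - b) *: sroot t.
  rewrite /= /refl !prE !pr_sroot !cartan_diag// cst cts.
  apply/funext => p; rewrite !fctE /= /GRing.scale /=; ring.
elim: j => [|j [IH1 IH2]].
  by rewrite chebU0 chebU1 !scale0r !scale1r addr0 oppr0 scale0r add0r mulr0 subr0 scale1r.
rewrite !iterS IH1 IH2 !us doubleS !chebUSS.
by split; congr (_ *: _ + _ *: _); ring.
Qed.

(** For an infinite label the relator is the empty word. For a finite one the form is nondegenerate
    on the plane of [s] and [t], and [x] splits into a part in the plane, where [st] has order
    dividing [m], and a part fixed by [st]. *)
Lemma act_relator s t x : s \in S -> t \in S ->
  act (flatten (nseq (gorder (s * t)%g) [:: s; t])) x = x.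
Proof.
move=> sS tS; rewrite act_flatten_nseq.
have [<-|st] := eqVneq s t.
  by rewrite (coxeter_invol hWS)// gorder1 /= reflK.
have := gorder_neq1 sS tS st; case em: gorder => [//|m] m1.
have m2 : (1 < m.+1)%N by lia.
have [i1 i2] := iter_dihedral m.+1 sS tS.
have [U1 U2] := chebU_double R m2.
set c := - cartan s t in i1 i2.
have ec : c = twocos R m.+1 by rewrite /c /cartan em opprK.
rewrite ec U1 U2 scale1r scale0r addr0 in i1.
rewrite ec U1 U2 oppr0 scale0r mulr0 subr0 scale1r add0r in i2.
have c0 : 0 <= c by rewrite oppr_ge0 cartan_le0.
have c2 : c < 2 by rewrite ec twocos_lt2.
have cst : cartan s t = - c by rewrite opprK.
have cts : cartan t s = - c by rewrite cartan_sym.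
have iterD y z : iter m.+1 (act [:: s; t]) (y + z) =
    iter m.+1 (act [:: s; t]) y + iter m.+1 (act [:: s; t]) z.
  by elim: (m.+1) => // n IH; rewrite !iterS IH actD.
have iterZ a y : iter m.+1 (act [:: s; t]) (a *: y) =
    a *: iter m.+1 (act [:: s; t]) y.
  by elim: (m.+1) => // n IH; rewrite !iterS IH actZ.
(* [d] is the Gram determinant of the two simple roots, and [xP] is the orthogonal projection of [x]
   to their plane by Cramer's rule. *)
pose p := pr x s; pose q := pr x t; pose d := 4 - c * c.
have d0 : d != 0 by rewrite /d; apply: lt0r_neq0; nra.
pose xP := ((2 * p + c * q) / d) *: sroot s + ((2 * q + c * p) / d) *: sroot t.
have xPK : iter m.+1 (act [:: s; t]) xP = xP by rewrite /xP iterD !iterZ i1 i2.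
rewrite -[x in LHS](subrK xP) addrC iterD xPK -[RHS](subrK xP) [RHS]addrC.
congr (_ + _).
have fixed : act [:: s; t] (x - xP) = x - xP.
  rewrite /= {2}/refl /xP !prE !pr_sroot !cartan_diag// cst.
  have -> : pr x t - ((2 * p + c * q) / d * - c + (2 * q + c * p) / d * 2) = 0.
    by rewrite -/q /d; field.
  rewrite scale0r subr0 /refl !prE !pr_sroot !cartan_diag// cts.
  have -> : pr x s - ((2 * p + c * q) / d * 2 + (2 * q + c * p) / d * - c) = 0.
    by rewrite -/p /d; field.
  by rewrite scale0r subr0.
by elim: (m.+1) => // n IH; rewrite iterSr fixed.
Qed.

(** Relators act trivially, so the action descends from words to [W], also on vectors outside the
    span of the simple roots. *)
Lemma act_eq l l' x : {subset l <= S} -> {subset l' <= S} -> prodw l = prodw l' ->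
  act l x = act l' x.
Proof.
move=> lS lS' e; case: hWS => _ _ /(_ (l ++ rev l')).
have step a b : clos_refl_sym_trans (seq W) (coxeter_step S) a b ->
    forall y, act a y = act b y.
  elim=> {a b} [_ _ [a b s t sS tS] y|//|a b _ h y|a b c _ h1 _ h2 y].
  - by rewrite !act_cat act_relator.
  - by rewrite h.
  - by rewrite h1 h2.
move=> h; have /h h1 : {subset l ++ rev l' <= S}.
  by apply: words_cat => //; apply: words_rev.
have /h1/step h' : prodw (l ++ rev l') = 1%g.
  by rewrite prodw_cat (prodw_rev (coxeter_invol hWS))// e mulgV.
by rewrite -{1}(act_revK x lS') -act_cat h'.
Qed.

Definition rep w x : V := act (red_word S w) x.

Lemma rep_word l x : {subset l <= S} -> rep (prodw l) x = act l x.
Proof.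
by move=> lS; apply: act_eq => //; have [] := red_wordP hWS (prodw l).
Qed.

Lemma rep1 x : rep 1%g x = x.
Proof. by rewrite -[1%g]prodw_nil rep_word. Qed.

Lemma rep_gen s x : s \in S -> rep s x = refl s x.
Proof. by move=> sS; rewrite -[s in LHS]prodw1 rep_word// => z; rewrite inE => /eqP->. Qed.

Lemma repM w w' x : rep (w * w')%g x = rep w (rep w' x).
Proof.
have [l1 w1 _] := red_wordP hWS w; have [l2 w2 _] := red_wordP hWS w'.
rewrite -{1}w1 -{1}w2 -prodw_cat rep_word ?act_cat//.
by move=> z; rewrite mem_cat => /orP[/l1|/l2].
Qed.

Lemma repK w x : rep w^-1%g (rep w x) = x.
Proof. by rewrite -repM mulVg rep1. Qed.

Lemma repVK w x : rep w (rep w^-1%g x) = x.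
Proof. by rewrite -repM mulgV rep1. Qed.

Lemma rep_inj w x y : rep w x = rep w y -> x = y.
Proof. by move=> h; rewrite -(repK w x) h repK. Qed.

Lemma repD w x y : rep w (x + y) = rep w x + rep w y. Proof. exact: actD. Qed.

Lemma repZ w a x : rep w (a *: x) = a *: rep w x. Proof. exact: actZ. Qed.

Lemma repN w x : rep w (- x) = - rep w x.
Proof. by rewrite -scaleN1r repZ scaleN1r. Qed.

Lemma repB w x y : rep w (x - y) = rep w x - rep w y.
Proof. by rewrite repD repN. Qed.

Lemma rep0 w : rep w 0 = 0.
Proof. by rewrite -[X in rep w X](subrr 0) repB subrr. Qed.

Lemma rep_sum w (I : Type) (r : seq I) (F : I -> V) :
  rep w (\sum_(i <- r) F i) = \sum_(i <- r) rep w (F i).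
Proof.
elim: r => [|i r IH]; first by rewrite !big_nil rep0.
by rewrite !big_cons repD IH.
Qed.

Lemma repM_gen w s x : s \in S -> rep (w * s)%g x = rep w (refl s x).
Proof. by move=> sS; rewrite repM (rep_gen _ sS). Qed.

Lemma repM_sroot w s : s \in S -> rep (w * s)%g (sroot s) = - rep w (sroot s).
Proof. by move=> sS; rewrite repM_gen// refl_sroot// repN. Qed.

(** Invariance of the form, [(w s, t) = (s, w^-1 t)], expressed through [pr] for want of a bilinear
    form in infinite rank. *)
Lemma pr_rep_sym w s t : s \in S -> t \in S ->
  pr (rep w (sroot s)) t = pr (rep w^-1%g (sroot t)) s.
Proof.
move=> sS tS; have [lS lw _] := red_wordP hWS w.
rewrite -lw -(prodw_rev (coxeter_invol hWS))// !rep_word//; last first.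
  exact: words_rev.
move: (red_word S w) lS => l {lw}.
elim: l s t sS tS => [|r l IH] s t sS tS; first by move=> _; exact: cartan_sym.
move=> /words_cons[rS lS] /=.
rewrite /refl !prE rev_cons act_rcons /refl !pr_sroot.
rewrite actD -scaleNr actZ !prE (IH _ _ sS tS lS) (IH _ _ sS rS lS).
by rewrite (cartan_sym tS rS); ring.
Qed.

End Geometric.


(** * Positivity of roots *)

Section Span.
Variables (R : realType) (W : groupType) (S : set W) (hWS : coxeter_system S).
Implicit Types (A B : set W) (s t w g : W) (l : seq W).
Local Notation V := (W * bool -> R^o).
Implicit Types (x y : V).
Local Notation sroot := (sroot R).

(** The span [V_A] of the simple roots of [A]. Since the coefficients must be those of [cf x],
    vectors of the span with the same coordinates are equal, [pr] included. *)
Definition inV A x := exists l, [/\ uniq l, {subset l <= A} &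
  x = \sum_(t <- l) cf x t *: sroot t].

Lemma cf_sum (I : Type) (r : seq I) (F : I -> V) t :
  cf (\sum_(i <- r) F i) t = \sum_(i <- r) cf (F i) t.
Proof.
elim: r => [|i r IH]; first by rewrite !big_nil.
by rewrite !big_cons cfD IH.
Qed.

Lemma pr_sum (I : Type) (r : seq I) (F : I -> V) t :
  pr (\sum_(i <- r) F i) t = \sum_(i <- r) pr (F i) t.
Proof.
elim: r => [|i r IH]; first by rewrite !big_nil.
by rewrite !big_cons prD IH.
Qed.

Lemma cf_lin l (c : W -> R) t : uniq l ->
  cf (\sum_(r <- l) c r *: sroot r) t = if t \in l then c t else 0.
Proof.
move=> ul; rewrite cf_sum; case: ifP => tl.
  rewrite (bigD1_seq t)//= cfZ cf_sroot eqxx mulr1 big1 ?addr0// => r rt.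
  by rewrite cfZ cf_sroot eq_sym (negPf rt) mulr0.
rewrite big_seq big1// => r rl.
rewrite cfZ cf_sroot (_ : t == r = false) ?mulr0//.
by apply/negP => /eqP e; rewrite e rl in tl.
Qed.

Lemma lin_widen l l' x : uniq l -> uniq l' -> {subset l <= l'} ->
  x = \sum_(t <- l) cf x t *: sroot t -> x = \sum_(t <- l') cf x t *: sroot t.
Proof.
move=> ul ul' ll' e; rewrite (bigID (mem l)) /= [X in _ + X]big1 ?addr0.
  rewrite {1}e -[RHS]big_filter; apply/perm_big/uniq_perm => //.
    exact: filter_uniq.
  by move=> t; rewrite mem_filter /=; have [/ll'->|] := boolP (t \in l).
by move=> t /negPf tl; rewrite e cf_lin// tl scale0r.
Qed.

Lemma inV_cf0 A x t : inV A x -> t \notin A -> cf x t = 0.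
Proof.
move=> [l [ul lA e]] tA; rewrite e cf_lin//; case: ifP => // /lA.
by rewrite (negPf tA).
Qed.

Lemma inV0 A : inV A 0.
Proof. by exists [::]; rewrite big_nil. Qed.

Lemma inV_sroot A s : s \in A -> inV A (sroot s).
Proof.
move=> sA; exists [:: s]; split=> //; first exact: words_seq1.
by rewrite big_seq1 cf_sroot eqxx scale1r.
Qed.

Lemma inVZ A a x : inV A x -> inV A (a *: x).
Proof.
move=> [l [ul lA e]]; exists l; split=> //.
by rewrite {1}e scaler_sumr; apply: eq_bigr => t _; rewrite scalerA.
Qed.

Lemma inVD A x y : inV A x -> inV A y -> inV A (x + y).
Proof.
move=> [l [ul lA e]] [l' [ul' lA' e']]; exists (undup (l ++ l')).
have sub1 : {subset l <= undup (l ++ l')}.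
  by move=> t tl; rewrite mem_undup mem_cat tl.
have sub2 : {subset l' <= undup (l ++ l')}.
  by move=> t tl; rewrite mem_undup mem_cat tl orbT.
split; first exact: undup_uniq.
  by move=> t; rewrite mem_undup mem_cat => /orP[/lA|/lA'].
transitivity (\sum_(t <- undup (l ++ l')) cf x t *: sroot t +
              \sum_(t <- undup (l ++ l')) cf y t *: sroot t).
  congr (_ + _); first exact: (lin_widen ul (undup_uniq _) sub1 e).
  exact: (lin_widen ul' (undup_uniq _) sub2 e').
by rewrite -big_split /=; apply: eq_bigr => t _; rewrite -scalerDl.
Qed.

Lemma inVN A x : inV A x -> inV A (- x).
Proof. by rewrite -scaleN1r; apply: inVZ. Qed.

Lemma inVB A x y : inV A x -> inV A y -> inV A (x - y).
Proof. by move=> hx hy; apply: inVD => //; apply: inVN. Qed.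

Lemma inV_sum A (I : eqType) (r : seq I) (F : I -> V) :
  (forall i, i \in r -> inV A (F i)) -> inV A (\sum_(i <- r) F i).
Proof.
elim: r => [|i r IH] h; first by rewrite big_nil; apply: inV0.
rewrite big_cons; apply: inVD; first by apply: h; rewrite mem_head.
by apply: IH => j jr; apply: h; rewrite in_cons jr orbT.
Qed.

Lemma inVS A B x : A `<=` B -> inV A x -> inV B x.
Proof.
by move=> AB [l [ul lA e]]; exists l; split=> // t /lA/set_mem/AB/mem_set.
Qed.

Lemma inV_restrict A B x : inV B x -> (forall t, t \in B -> t \notin A -> cf x t = 0) ->
  inV A x.
Proof.
move=> [l [ul lB e]] h; exists [seq t <- l | t \in A]; split.
- exact: filter_uniq.
- by move=> t; rewrite mem_filter => /andP[].
rewrite big_filter {1}e (bigID (fun t => t \in A)) /= [X in _ + X]big1_seq ?addr0//.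
by move=> t /andP[tA /lB tB]; rewrite h// scale0r.
Qed.

Lemma inV_eq A x y : inV A x -> inV A y -> (forall t, cf x t = cf y t) -> x = y.
Proof.
move=> hx hy h; apply/eqP; rewrite -subr_eq0; apply/eqP.
have [l [_ _ ->]] := inVB hx hy.
by rewrite big1// => t _; rewrite cfB h subrr scale0r.
Qed.

Lemma inV_refl A s x : s \in A -> inV A x -> inV A (refl s x).
Proof. by move=> sA hx; apply: inVB => //; apply/inVZ/inV_sroot. Qed.

Lemma inV_rep A g x : A `<=` S -> gen_words A g -> inV A x -> inV A (rep S g x).
Proof.
move=> AS [l lA <-] hx; rewrite (rep_word hWS); last by move=> t /lA/set_mem/AS/mem_set.
by elim: l lA => //= s l IH /words_cons[sA /IH h]; apply: inV_refl.
Qed.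

Lemma inV_repS g x : inV S x -> inV S (rep S g x).
Proof. by apply: inV_rep => //; apply: coxeter_words. Qed.

Lemma inV_root g s : s \in S -> inV S (rep S g (sroot s)).
Proof. by move=> sS; apply/inV_repS/inV_sroot. Qed.

(** [refl s] changes only the [s]-coordinate, for any vector [x]. *)
Lemma cf_rep_notin A g x t : A `<=` S -> gen_words A g -> t \notin A ->
  cf (rep S g x) t = cf x t.
Proof.
move=> AS [l lA <-] tA; rewrite (rep_word hWS); last by move=> r /lA/set_mem/AS/mem_set.
elim: l lA => //= s l IH /words_cons[sA /IH h]; rewrite cf_refl//.
by apply: contraNneq tA => ->.
Qed.

Lemma inV_ind A (P : V -> Prop) :
  P 0 -> (forall x y, P x -> P y -> P (x + y)) -> (forall a x, P x -> P (a *: x)) ->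
  (forall s, s \in A -> P (sroot s)) -> forall x, inV A x -> P x.
Proof.
move=> P0 PD PZ Ps x [l [_ lA ->]]; rewrite big_seq.
by apply: big_ind => // t tl; apply/PZ/Ps/lA.
Qed.

Definition posv x := forall t, 0 <= cf x t.

Lemma posvD x y : posv x -> posv y -> posv (x + y).
Proof. by move=> hx hy t; rewrite cfD addr_ge0. Qed.

Lemma posvZ a x : 0 <= a -> posv x -> posv (a *: x).
Proof. by move=> a0 hx t; rewrite cfZ mulr_ge0. Qed.

Lemma posv_sroot s : posv (sroot s).
Proof. by move=> t; rewrite cf_sroot ler0n. Qed.

Lemma posv_anti A x : inV A x -> posv x -> posv (- x) -> x = 0.
Proof.
move=> hx px nx; apply: (inV_eq hx (inV0 A)) => t; rewrite cf0.
by apply/eqP; rewrite eq_le px -oppr_ge0 -cfN nx.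
Qed.

Lemma sroot_neq0 s : sroot s <> 0.
Proof.
move=> e; have := cf_sroot R s s; rewrite e cf0 eqxx => /esym/eqP.
by rewrite oner_eq0.
Qed.

Lemma pr_lin A x t : inV A x -> exists l, [/\ uniq l, {subset l <= A},
  (forall r, r \notin l -> cf x r = 0) & pr x t = \sum_(r <- l) cf x r * cartan R r t].
Proof.
move=> [l [ul lA e]]; exists l; split=> //.
  by move=> r /negPf rl; rewrite e cf_lin// rl.
by rewrite {1}e pr_sum; apply: eq_bigr => r _; rewrite prZ pr_sroot.
Qed.

(** Off the diagonal all Cartan entries are nonpositive. *)
Lemma pr_pos_le0 A x t : A `<=` S -> t \in S -> t \notin A -> inV A x -> posv x ->
  pr x t <= 0.
Proof.
move=> AS tS tA /(@pr_lin _ _ t)[l [ul lA _ ->]] px; rewrite big_seq.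
apply: sumr_le0 => r /lA rA; rewrite mulr_ge0_le0//.
apply: (cartan_le0 _ hWS) => //; first by move/set_mem/AS/mem_set: rA.
by apply: contraNneq tA => <-.
Qed.

Lemma pr_pos_eq0 A x t : A `<=` S -> t \in S -> t \notin A -> inV A x -> posv x ->
  pr x t = 0 -> forall r, cf x r * cartan R r t = 0.
Proof.
move=> AS tS tA /(@pr_lin _ _ t)[l [ul lA l0 ->]] px h r.
have [rl|/l0->] := boolP (r \in l); last by rewrite mul0r.
have le0 i : i \in l -> cf x i * cartan R i t <= 0.
  move=> /lA iA; rewrite mulr_ge0_le0//.
  apply: (cartan_le0 _ hWS) => //; first by move/set_mem/AS/mem_set: iA.
  by apply: contraNneq tA => <-.
apply/eqP; rewrite eq_le le0//= -h (bigD1_seq r)//= gerDl.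
by rewrite big_seq_cond; apply: sumr_le0 => i /andP[/le0].
Qed.

End Span.

Section Positivity.
Variables (R : realType) (W : groupType) (S : set W) (hWS : coxeter_system S).
Implicit Types (A B : set W) (s t w g h : W) (l : seq W).
Local Notation V := (W * bool -> R^o).
Implicit Types (x y : V).
Local Notation sroot := (sroot R).
Local Notation len := (coxeter_length S).
Local Notation rep := (rep S).

Lemma len_mul w w' : (len (w * w')%g <= len w + len w')%N.
Proof.
have [l1 w1 z1] := red_wordP hWS w; have [l2 w2 z2] := red_wordP hWS w'.
by rewrite -z1 -z2 -size_cat -{1}w1 -{1}w2 -prodw_cat; apply/(len_le)/words_cat.
Qed.

(** The alternating word of length [j] that ends in [t]; it grows on the left. *)
Fixpoint alt s t j : seq W :=
  if j is i.+1 then (if odd i then s else t) :: alt s t i else [::].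

Lemma size_alt s t j : size (alt s t j) = j.
Proof. by elim: j => //= j ->. Qed.

Lemma alt_sub s t j : s \in S -> t \in S -> {subset alt s t j <= S}.
Proof.
move=> sS tS; elim: j => //= j IH z; rewrite in_cons => /orP[/eqP->|/IH//].
by case: ifP.
Qed.

Lemma alt_rcons s t j : alt t s j.+1 = rcons (alt s t j) s.
Proof.
elim: j => // j IH; rewrite [LHS]/= -/(alt t s j.+1) IH [alt s t j.+1]/=.
by case: (odd j).
Qed.

Lemma alt_braid s t : s \in S -> t \in S ->
  prodw (alt s t (gorder (s * t)%g)) = prodw (alt t s (gorder (s * t)%g)).
Proof.
move=> sS tS.
have shift (a b : W) j : (a * (b * a) ^+ j * b = (a * b) ^+ j.+1)%g.
  by elim: j => [|j IH]; rewrite ?expg0 ?mulg1 ?expg1// [RHS]expgS -IH expgS !mulgA.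
have key j : (prodw (alt s t j) * (prodw (alt t s j))^-1 =
    if odd j then (t * s) ^+ j else (s * t) ^+ j)%g.
  elim: j => [|j IH]; first by rewrite prodw_nil invg1 mulg1.
  rewrite /= !prodw_cons invgM mulgA -[((if _ then _ else _) * _ / _)%g]mulgA IH.
  case: (odd j) => /=; rewrite (invg_involution (coxeter_invol hWS))//; exact: shift.
apply: divg1_eq; rewrite key; case: odd; last exact: expg_gorder.
suff -> : (t * s = (s * t)^-1)%g by rewrite -gorderV expg_gorder.
by rewrite invgM !(invg_involution (coxeter_invol hWS)).
Qed.

Lemma act_alt s t j : s \in S -> t \in S -> let c := - cartan R s t in
  act (alt s t j) (sroot s) =
    chebU c (if odd j then j else j.+1) *: sroot s +
    chebU c (if odd j then j.+1 else j) *: sroot t.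
Proof.
move=> sS tS c; have cst : cartan R s t = - c by rewrite opprK.
have cts : cartan R t s = - c by rewrite (cartan_sym R hWS).
elim: j => [|j IH]; first by rewrite /= chebU0 chebU1 scale1r scale0r addr0.
rewrite [LHS]/= IH /=; case: (odd j) => /=; rewrite chebUSS reflD !reflZ.
  rewrite (refl_sroot _ hWS)// {1}/refl pr_sroot cts.
  apply/funext => p; rewrite !fctE /= /GRing.scale /=; ring.
rewrite (refl_sroot _ hWS)// {1}/refl pr_sroot cst.
apply/funext => p; rewrite !fctE /= /GRing.scale /=; ring.
Qed.

(* Letters [t], [s], [t], ... are removed from the right of [w] while the length drops: what
   remains sends both simple roots to positive vectors, and the removed alternating word,
   being shorter than the label, has nonnegative (Chebyshev) coefficients on them. *)
Theorem root_pos w s : s \in S -> len (w * s)%g = (len w).+1 ->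
  posv (rep w (sroot s)).
Proof.
have [n] := ubnP (len w); elim: n w s => // n IH w s /ltnSE wn sS ws.
have [->|w1] := pselect (w = 1%g).
  by rewrite (rep1 hWS); apply: posv_sroot.
have [t tS wt] := len_descent hWS w1.
have st : s != t by apply: contra_eq_neq wt => <-; rewrite ws; lia.
pose v j := (w * (prodw (alt s t j))^-1)%g.
pose r j := if odd j then s else t.
have rS j : r j \in S by rewrite /r; case: ifP.
have invr j : ((r j)^-1 = r j)%g by apply: (invg_involution (coxeter_invol hWS)).
have vS j : v j.+1 = (v j * r j)%g by rewrite /v /= prodw_cons invgM mulgA -/(r j) invr.
have wv j : w = (v j * prodw (alt s t j))%g by rewrite /v mulgVK.
have lw j : (len w <= len (v j) + j)%N.
  rewrite {1}(wv j) (leq_trans (len_mul _ _))// leq_add2l -[X in (_ <= X)%N](size_alt s t).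
  exact/len_le/alt_sub.
have lv i j : (i <= j)%N -> (len (v i) <= len (v j) + (j - i))%N.
  elim: j => [|j IHj]; first by rewrite leqn0 => /eqP->; rewrite subnn addn0.
  rewrite leq_eqVlt => /orP[/eqP->|]; first by rewrite subnn addn0.
  rewrite ltnS => ij; have := IHj ij; have := len_prod_gen hWS (v j) (rS j).
  by rewrite -vS; lia.
(* [P j] says that each of the [j] removed letters has lowered the length; [j] is then taken
   maximal. *)
pose P j := (len (v j) + j == len w)%N.
have P1 : P 1%N by rewrite /P vS /v /= prodw_nil invg1 mulg1 wt addn1.
have exP : exists i, P i by exists 1%N.
have bndP i : P i -> (i <= len w)%N by move=> /eqP <-; rewrite leq_addl.
case: (ex_maxnP exP bndP) => j Pj maxj.
have j1 : (1 <= j)%N by apply: maxj.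
have lvj : (len (v j) < len w)%N by move: Pj; rewrite /P => /eqP; lia.
(* [r j] and [r j.-1] are [s] and [t] in some order. The former is an ascent of [v j] by maximality
   of [j], the latter because multiplying by it undoes the last removal. *)
have prp (j' : nat) : j' \in [:: j; j.-1] -> posv (rep (v j) (sroot (r j'))).
  move=> hj'; apply: IH => //; first exact: leq_trans lvj wn.
  move: hj'; rewrite !inE => /orP[|] /eqP->.
    case: (len_prod_gen hWS (v j) (rS j)) => // e.
    suff /maxj : P j.+1 by rewrite ltnn.
    by move: Pj e; rewrite /P vS => /eqP <- ->; rewrite addnS.
  have -> : (v j * r j.-1)%g = v j.-1.
    by rewrite -(prednK j1) vS /= -mulgA -{2}invr mulgV mulg1.
  case: (len_prod_gen hWS (v j.-1) (rS j.-1)); rewrite -vS prednK// => e //.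
  by move: (lw j.-1) Pj e; rewrite /P => + /eqP; lia.
have hst : posv (rep (v j) (sroot s)) /\ posv (rep (v j) (sroot t)).
  have := prp j; have := prp j.-1; rewrite !inE !eqxx orbT => /(_ isT) + /(_ isT).
  by rewrite /r -[in odd j](prednK j1) /=; case: odd.
rewrite {1}(wv j) (repM hWS) (rep_word hWS); last exact: alt_sub.
rewrite act_alt// repD !repZ.
suff Upos i : (i <= j.+1)%N -> 0 <= chebU (- cartan R s t) i.
  by case: hst => h1 h2; apply: posvD; apply: posvZ => //; apply: Upos; case: (odd _).
move=> ij; rewrite opprK; apply: chebU_twocos_ge0; first exact: (gorder_neq1 hWS).
set m := gorder _; have [//|m0] := eqVneq m 0%N.
rewrite /= (leq_trans ij)// ltnNge; apply/negP => mj.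
(* If the label [m] were at most [j], the braid relation would turn the removed word of length [m]
   into one ending in [s], making [s] a descent of [w]. *)
have em : (len (v m) + m <= len w)%N.
  by have := lv _ _ mj; move: Pj; rewrite /P => /eqP; lia.
case: m m0 mj em (alt_braid sS tS : prodw (alt s t m) = prodw (alt t s m)) => // m _ mj em eb.
have : (len (w * s)%g <= len (v m.+1) + m)%N.
  have -> : (w * s = v m.+1 * prodw (alt s t m))%g.
    rewrite {1}(wv m.+1) eb alt_rcons prodw_rcons -!mulgA.
    by rewrite (coxeter_invol hWS)// mulg1.
  rewrite (leq_trans (len_mul _ _))// leq_add2l -[X in (_ <= X)%N](size_alt s t).
  exact/len_le/alt_sub.
by rewrite ws; lia.
Qed.

End Positivity.



(** * Inversions *)

Section FiniteAction.
Variables (W : groupType) (X : choiceType).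

Lemma finite_words (O : set X) n : finite_set O ->
  finite_set [set l : seq X | size l = n /\ forall x, x \in l -> O x].
Proof.
move=> fO; elim: n => [|n IH].
  by apply: (@sub_finite_set _ _ [set [::]]); [move=> l [/size0nil] | exact: finite_set1].
apply: sub_finite_set (finite_image2 cons fO IH) => -[[]//|x l] [[sl] h].
exists x; first by apply: h; rewrite mem_head.
by exists l => //; split=> // y yl; apply: h; rewrite in_cons yl orbT.
Qed.

(** An element of [P] is coded by its values on an enumeration of [O], and there are finitely many
    codes. *)
Lemma finite_faithful (P : set W) (O : set X) (f : W -> X -> X) :
  finite_set O -> (forall g x, P g -> O x -> O (f g x)) ->
  (forall g h, P g -> P h -> (forall x, O x -> f g x = f h x) -> g = h) ->
  finite_set P.
Proof.
move=> fO stab inj; have /finite_seqP[os eO] := fO.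
have Os x : x \in os -> O x by rewrite eO.
pose code g := [seq f g x | x <- os].
apply: sub_finite_set (finite_image (fun c => xget 1%g [set g | P g /\ code g = c])
  (finite_words (size os) fO)) => g Pg.
exists (code g).
  split; first by rewrite size_map.
  by move=> y /mapP[x /Os Ox ->]; apply: stab.
case: xgetP => [h _ [Ph /eq_in_map e]|no].
  by apply: inj => // x; rewrite eO => /= /e.
by case: (no g).
Qed.

End FiniteAction.

Section Roots.
Variables (R : realType) (W : groupType) (S : set W) (hWS : coxeter_system S).
Implicit Types (A B : set W) (s t w g h : W) (l : seq W).
Local Notation V := (W * bool -> R^o).
Implicit Types (x y : V).
Local Notation sroot := (sroot R).
Local Notation len := (coxeter_length S).
Local Notation rep := (rep S).

Lemma root_neg w s : s \in S -> len w = (len (w * s)%g).+1 ->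
  posv (- rep w (sroot s)).
Proof.
move=> sS e; have : len (w * s * s)%g = (len (w * s)%g).+1.
  by rewrite -mulgA (coxeter_invol hWS)// mulg1.
by move=> /(root_pos R hWS sS); rewrite (repM_sroot _ hWS)//.
Qed.

Lemma root_sign w s : s \in S -> posv (rep w (sroot s)) \/ posv (- rep w (sroot s)).
Proof.
move=> sS; case: (len_prod_gen hWS w sS) => e; first by left; apply: root_pos.
by right; apply: root_neg.
Qed.

Lemma root_not_both w s : s \in S -> posv (rep w (sroot s)) ->
  posv (- rep w (sroot s)) -> False.
Proof.
move=> sS px nx; have := posv_anti (inV_root R hWS w sS) px nx.
by rewrite -(rep0 R S w) => /(rep_inj hWS) /sroot_neq0.
Qed.

Lemma neg_descent w s : s \in S -> posv (- rep w (sroot s)) ->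
  len w = (len (w * s)%g).+1.
Proof.
move=> sS nx; case: (len_prod_gen hWS w sS) => // e.
by case: (root_not_both sS (root_pos R hWS sS e) nx).
Qed.

Lemma eq1_of_pos w : (forall s, s \in S -> posv (rep w (sroot s))) -> w = 1%g.
Proof.
move=> h; apply: contrapT => /(len_descent hWS)[s sS /(root_neg sS)].
exact: root_not_both (h s sS).
Qed.

(** All simple roots have norm 2 and norms are preserved; [pr_rep_sym] stands in for the norm. *)
Lemma root_scalar g s t (c : R) : s \in S -> t \in S ->
  rep g (sroot s) = c *: sroot t -> c ^+ 2 = 1.
Proof.
move=> sS tS e; have c0 : c != 0.
  apply: contraPneq e => ->; rewrite scale0r -(rep0 R S g) => /(rep_inj hWS).
  exact: sroot_neq0.
have e' : rep g^-1%g (sroot t) = c^-1 *: sroot s.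
  by rewrite -[RHS](repK hWS g) repZ e scalerA mulVf// scale1r.
have := pr_rep_sym R hWS g sS tS.
rewrite e e' !prZ !pr_sroot !(cartan_diag _ hWS)// => /(congr1 (fun z => c * z)).
by rewrite !mulrA mulfV// expr2; lra.
Qed.

(** The product [g s g^-1 t] moves a simple root only by a multiple of the root of [t] and fixes the
    latter, so it keeps all simple roots positive and is 1. *)
Lemma reflection_eq g s t : s \in S -> t \in S -> rep g (sroot s) = sroot t ->
  (g * s * g^-1 = t)%g.
Proof.
move=> sS tS e; suff : (g * s * g^-1 * t)%g = 1%g.
  by move=> /mulg1_eq <-; rewrite !invgM invgK (invg_involution (coxeter_invol hWS) sS) mulgA.
apply: eq1_of_pos => r rS.
have key x : rep (g * s * g^-1)%g x = x - pr (rep g^-1%g x) s *: sroot t.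
  by rewrite (repM hWS) (repM_gen hWS)// /refl repB repZ e (repVK hWS).
have [z ez] : exists z, rep (g * s * g^-1 * t)%g (sroot r) = sroot r + z *: sroot t.
  rewrite (repM_gen hWS)// key.
  set b := pr _ s; rewrite /refl -addrA -opprD -scalerDl.
  by exists (- (pr (sroot r) t + b)); rewrite scaleNr.
case: (root_sign (g * s * g^-1 * t)%g rS) => // neg u.
have [rt|rt] := eqVneq r t.
  move: neg; rewrite rt (repM_sroot _ hWS)// opprK key.
  have -> : rep g^-1%g (sroot t) = sroot s by rewrite -e (repK hWS).
  rewrite pr_sroot (cartan_diag _ hWS)//.
  have -> : sroot t - 2 *: sroot t = - sroot t.
    by rewrite -[X in X - _]scale1r -scalerBl -[RHS]scaleN1r; congr (_ *: _); lra.
  by rewrite opprK => _; apply: posv_sroot.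
have := neg r; rewrite ez cfN cfD cfZ !cf_sroot eqxx (negPf rt) mulr0 addr0.
by rewrite oppr_ge0 ler10.
Qed.

(** Only the [t]-coordinate can change sign under [refl t], so the root is a multiple of [sroot t],
    and the factor is 1 by [root_scalar]. *)
Lemma simple_of_neg g s t : s \in S -> t \in S -> posv (rep g (sroot s)) ->
  posv (- refl t (rep g (sroot s))) -> rep g (sroot s) = sroot t.
Proof.
move=> sS tS px nx; set x := rep g _ in px nx *.
have z r : r != t -> cf x r = 0.
  move=> rt; apply/eqP; rewrite eq_le px -oppr_ge0 -(cf_refl x rt) -cfN.
  by rewrite nx.
have ex : x = cf x t *: sroot t.
  apply: (inV_eq (inV_root R hWS g sS)); first by apply/inVZ/inV_sroot.
  move=> r; rewrite cfZ cf_sroot; have [->|rt] := eqVneq r t; first by rewrite mulr1.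
  by rewrite -[false%:R]/(0 : R) mulr0; apply: z.
have /eqP := root_scalar sS tS ex; rewrite sqrf_eq1 => /orP[]/eqP c1.
  by rewrite ex c1 scale1r.
by have := px t; rewrite c1 oppr_ge0 ler10.
Qed.

Definition root_set A : set V :=
  [set x | exists g s, [/\ gen_words A g, s \in A & x = rep g (sroot s)]].

Lemma rootsS A B : A `<=` B -> root_set A `<=` root_set B.
Proof.
move=> AB x [g [s [gA sA ->]]]; exists g, s; split=> //.
  exact: gen_wordsS AB gA.
exact/mem_set/AB/set_mem.
Qed.

Lemma roots_sroot A s : s \in A -> root_set A (sroot s).
Proof. by move=> sA; exists 1%g, s; rewrite (rep1 hWS); split=> //; exact: gen_words1. Qed.

Lemma roots_rep A g x : gen_words A g -> root_set A x -> root_set A (rep g x).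
Proof.
move=> gA [h [s [hA sA ->]]]; exists (g * h)%g, s; rewrite (repM hWS); split=> //.
exact: gen_wordsM.
Qed.

Lemma rootsN A x : A `<=` S -> root_set A x -> root_set A (- x).
Proof.
move=> AS [h [s [hA sA ->]]]; exists (h * s)%g, s; split=> //.
  by apply: gen_wordsM => //; apply: gen_words_gen.
have sS : s \in S by apply/mem_set/AS/set_mem.
by rewrite (repM_sroot _ hWS)//.
Qed.

Lemma roots_inV A x : A `<=` S -> root_set A x -> inV A x.
Proof. by move=> AS [h [s [hA sA ->]]]; apply: inV_rep => //; apply: inV_sroot. Qed.

Lemma roots_all g s : s \in S -> root_set S (rep g (sroot s)).
Proof. by move=> sS; apply: roots_rep; [exact: coxeter_words | exact: roots_sroot]. Qed.

Lemma roots_sign x : root_set S x -> posv x \/ posv (- x).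
Proof. by move=> [g [s [_ sS ->]]]; apply: root_sign. Qed.

Lemma roots_not_both x : root_set S x -> posv x -> posv (- x) -> False.
Proof. by move=> [g [s [_ sS ->]]]; apply: root_not_both. Qed.

Lemma roots_simple x t : t \in S -> root_set S x -> posv x -> posv (- refl t x) ->
  x = sroot t.
Proof. by move=> tS [g [s [_ sS ->]]]; apply: simple_of_neg. Qed.

Definition inversions w : set V := [set x | [/\ root_set S x, posv x & posv (- rep w x)]].

(** Appending a letter [t] to a word creates at most one new inversion, the simple root of [t]. *)
Lemma finite_inversions w : finite_set (inversions w).
Proof.
have [l lS <-] := coxeter_words hWS w.
elim/last_ind: l lS => [|l t IH] lS.
  apply: (@sub_finite_set _ _ set0); last exact: finite_set0.
  move=> x [rx px]; rewrite prodw_nil (rep1 hWS); exact: roots_not_both.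
have [lS' tS] := words_rcons lS.
apply: (@sub_finite_set _ _ ([set sroot t] `|` refl t @` inversions (prodw l))).
  move=> x [rx px nx]; rewrite prodw_rcons (repM_gen hWS)// in nx.
  have rtx : root_set S (refl t x).
    by rewrite -(rep_gen hWS)//; apply: roots_rep => //; apply: coxeter_words.
  case: (roots_sign rtx) => sx; last by left; apply: roots_simple sx.
  right; exists (refl t x); last by rewrite (reflK hWS).
  by [].
by rewrite finite_setU; split; [exact: finite_set1 | exact/finite_image/IH].
Qed.

(** Exchange condition. Where the root of [s] turns negative along the word it is simple, so the
    letter at that place is a conjugate of [s] and cancels against it. *)
Lemma exchange l s : {subset l <= S} -> s \in S -> posv (- act l (sroot s)) ->
  exists l1 r l2, l = l1 ++ r :: l2 /\ (prodw l * s = prodw (l1 ++ l2))%g.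
Proof.
elim: l => [|r l IH] lS sS /= nx.
  case: (@root_not_both 1%g s sS); rewrite (rep1 hWS)//; exact: posv_sroot.
have [rS {}lS] := words_cons lS.
rewrite -(rep_word hWS)// in nx.
case: (root_sign (prodw l) sS) => sx.
  exists [::], r, l; split=> //=.
  have /(reflection_eq sS rS) <- := simple_of_neg sS rS sx nx.
  rewrite prodw_cons -!mulgA [(_^-1 * _)%g]mulgA mulVg mul1g.
  by rewrite (coxeter_invol hWS)// mulg1.
have [|l1 [r' [l2 [-> e]]]] := IH lS sS; first by rewrite -(rep_word hWS).
by exists (r :: l1), r', l2; split=> //=; rewrite !prodw_cons -mulgA e.
Qed.

(** Signs are known on [A] only, so the induction is on a word in [A]: its last letter is no
    descent, hence the exchange condition yields a shorter word in [A]. *)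
Lemma parab_eq1 A h : A `<=` S -> gen_words A h ->
  (forall s, s \in A -> posv (rep h (sroot s))) -> h = 1%g.
Proof.
move=> AS [l lA <-]; have [n] := ubnP (size l).
elim: n l lA => // n IH l lA /ltnSE ln pos.
case/lastP: l lA ln pos => [|l s] lA ln pos; first exact: prodw_nil.
have [lA' sA] := words_rcons lA.
have toS l0 : {subset l0 <= A} -> {subset l0 <= S}.
  by move=> h0 z /h0/set_mem/AS/mem_set.
have sS : s \in S by apply/mem_set/AS/set_mem.
have nx : posv (- act l (sroot s)).
  have := pos s sA; rewrite (rep_word hWS) ?act_rcons ?(refl_sroot _ hWS)//; last exact: toS.
  by rewrite -scaleN1r actZ scaleN1r.
have [l1 [r [l2 [el e]]]] := exchange (toS _ lA') sS nx.
rewrite prodw_rcons e; apply: IH.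
- by move=> z zl; apply: lA'; rewrite el; move: zl; rewrite !mem_cat in_cons => /orP[]->; rewrite ?orbT.
- by move: ln; rewrite size_rcons el !size_cat /=; lia.
- by rewrite -e -prodw_rcons.
Qed.

(** [W_A] acts faithfully on its roots. *)
Lemma finite_pos_roots A : A `<=` S -> finite_set [set x | root_set A x /\ posv x] ->
  finite_set (gen_words A).
Proof.
move=> AS fin; apply: (@finite_faithful _ _ _ (root_set A) (fun g x => rep g x)).
- apply: (@sub_finite_set _ _ ([set x | root_set A x /\ posv x] `|`
    -%R @` [set x | root_set A x /\ posv x])); last first.
    by rewrite finite_setU; split=> //; exact: finite_image.
  move=> x rx; case: (roots_sign (rootsS AS rx)) => px; first by left.
  by right; exists (- x); [split=> //; exact: rootsN | rewrite opprK].
- by move=> g x gA; apply: roots_rep.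
move=> g h gA hA e.
have AI : involutive_set A by move=> s /set_mem/AS/mem_set/(coxeter_invol hWS).
suff : (h^-1 * g)%g = 1%g by move=> /mulg1_eq; rewrite invgK.
apply: (parab_eq1 AS).
  by apply: gen_wordsM => //; apply: gen_wordsV.
move=> s sA; rewrite (repM hWS) e ?(repK hWS); first exact: posv_sroot.
exact: roots_sroot.
Qed.

(** [w] need not lie in [W_A]: every positive root of [A] is one of its finitely many inversions. *)
Lemma finite_parab A w : A `<=` S -> (forall s, s \in A -> posv (- rep w (sroot s))) ->
  finite_set (gen_words A).
Proof.
move=> AS neg; apply: finite_pos_roots => //.
apply: sub_finite_set (finite_inversions w) => x [rx px]; split=> //.
  exact: rootsS AS _ rx.
have [l [_ lA e]] := roots_inV AS rx.
rewrite e rep_sum -sumrN => t; rewrite cf_sum big_seq.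
apply: sumr_ge0 => r /lA /neg h; rewrite repZ -scalerN cfZ; exact: mulr_ge0.
Qed.

End Roots.



(** * Pairs of roots with large product *)

Section HeightSequence.
Variable R : realType.

Lemma lt_natmul (M e : R) : 0 < e -> exists k : nat, M < k%:R * e.
Proof.
move=> e0; exists (Num.bound (`|M| / e)).
rewrite -ltr_pdivrMr//; apply: le_lt_trans (archi_boundP _); last first.
  by rewrite divr_ge0// ltW.
by rewrite ler_pM2r ?invr_gt0// ler_norm.
Qed.

(* Such a sequence is strictly concave. *)
Lemma no_positive_recurrence (h : nat -> R) (t : R) : t < 2 ->
  (forall i, 0 < h i) -> (forall i, h i.+2 = t * h i.+1 - h i) -> False.
Proof.
move=> t2 h0 hrec; pose d i := h i.+1 - h i.
have dS i : d i.+1 = d i - (2 - t) * h i.+1 by rewrite /d hrec; ring.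
have ddec i : d i.+1 <= d i.
  by rewrite dS gerBl mulr_ge0 ?ltW// subr_gt0.
have dle i k : d (i + k)%N <= d i.
  by elim: k => [|k IH]; rewrite ?addn0// addnS (le_trans (ddec _)).
(* The differences decrease, so a negative one would eventually drive [h] below 0. *)
have d0 i : 0 <= d i.
  rewrite leNgt; apply/negP => di.
  have [|k hk] := @lt_natmul (h i) (- d i); first by rewrite oppr_gt0.
  suff : h (i + k)%N <= h i + k%:R * d i.
    by have := h0 (i + k)%N; move: hk; clear; lra.
  elim: k {hk} => [|k IH]; first by rewrite addn0 mul0r addr0.
  have := dle i k; rewrite {1}/d addnS -natr1; move: IH; clear; lra.
have hge i : h 0%N <= h i.
  by elim: i => // i IH; have := d0 i; rewrite /d; move: IH; clear; lra.
(* As [h] is nondecreasing, each difference drops by at least [(2 - t) * h 0], and so becomes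
   negative. *)
have [|k hk] := @lt_natmul (d 0%N) ((2 - t) * h 0%N).
  by rewrite mulr_gt0 ?subr_gt0.
suff : d k <= d 0%N - k%:R * ((2 - t) * h 0%N).
  by have := d0 k; move: hk; clear; lra.
elim: k {hk} => [|k IH]; first by rewrite mul0r subr0.
have : (2 - t) * h 0%N <= (2 - t) * h k.+1 by rewrite ler_pM2l ?subr_gt0.
by rewrite dS -natr1; move: IH; clear; lra.
Qed.

End HeightSequence.

(** * Finite rank: the form, products of two reflections, and products of roots below 2 *)

Section FiniteRank.
Variables (R : realType) (W : groupType) (S : set W) (hWS : coxeter_system S).
Variables (J : seq W) (uJ : uniq J) (JS : {subset J <= S}).
Implicit Types (s t w g h u : W) (l : seq W).
Local Notation V := (W * bool -> R^o).
Implicit Types (x y z a b : V).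
Local Notation sroot := (sroot R).
Local Notation rep := (rep S).
Local Notation root_set := (@root_set R W S).
Local Notation A := [set` J].

Let AS : A `<=` S.
Proof. by move=> s /JS /set_mem. Qed.

Let memA s : (s \in A) = (s \in J).
Proof. by rewrite mem_setE. Qed.

Lemma inV_seq x : inV A x -> x = \sum_(t <- J) cf x t *: sroot t.
Proof.
move=> [l [ul lA e]]; apply: lin_widen ul uJ _ e.
by move=> t /lA; rewrite memA.
Qed.

Definition bil x y : R := \sum_(t <- J) cf x t * pr y t.

Lemma bilDl x y z : bil (x + y) z = bil x z + bil y z.
Proof. by rewrite -big_split; apply: eq_bigr => t _; rewrite /= cfD mulrDl. Qed.

Lemma bilZl c x z : bil (c *: x) z = c * bil x z.
Proof. by rewrite mulr_sumr; apply: eq_bigr => t _; rewrite cfZ mulrA. Qed.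

Lemma bilNl x z : bil (- x) z = - bil x z.
Proof. by rewrite -scaleN1r bilZl mulN1r. Qed.

Lemma bil0l z : bil 0 z = 0.
Proof. by rewrite /bil big1// => t _; rewrite cf0 mul0r. Qed.

Lemma bil_suml (I : Type) (r : seq I) (F : I -> V) z :
  bil (\sum_(i <- r) F i) z = \sum_(i <- r) bil (F i) z.
Proof. exact: (big_morph (bil^~ z) (fun x y => bilDl x y z) (bil0l z)). Qed.

Lemma bil_null x y : (forall t, t \in J -> pr y t = 0) -> bil x y = 0.
Proof. by move=> h; rewrite /bil big_seq big1// => t /h ->; rewrite mulr0. Qed.

Lemma bilDr x y z : bil x (y + z) = bil x y + bil x z.
Proof. by rewrite -big_split; apply: eq_bigr => t _; rewrite /= prD mulrDr. Qed.

Lemma bilZr c x z : bil x (c *: z) = c * bil x z.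
Proof. by rewrite mulr_sumr; apply: eq_bigr => t _; rewrite prZ mulrCA. Qed.

Lemma bil_sroot_l s y : s \in J -> bil (sroot s) y = pr y s.
Proof.
move=> sJ; rewrite /bil (bigD1_seq s)//= cf_sroot eqxx mul1r big1 ?addr0//.
by move=> t /negPf ts; rewrite cf_sroot ts mul0r.
Qed.

Lemma bil_sroot_r x s : inV A x -> s \in J -> bil x (sroot s) = pr x s.
Proof.
move=> hx sJ; rewrite [X in pr X _](inV_seq hx) pr_sum /bil !big_seq.
apply: eq_bigr => t tJ; rewrite prZ !pr_sroot; congr (_ * _).
by apply: (cartan_sym R hWS); exact: JS.
Qed.

Lemma bil_sym x y : inV A x -> inV A y -> bil x y = bil y x.
Proof.
move=> hx hy; rewrite [in RHS](inV_seq hx) /bil.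
under eq_bigr => t _ do idtac.
transitivity (\sum_(t <- J) cf x t * bil y (sroot t)).
  by apply: eq_big_seq => t tJ; rewrite bil_sroot_r.
rewrite -[RHS]/(bil y (\sum_(t <- J) cf x t *: sroot t)).
elim: J => [|t l IH]; first by rewrite !big_nil -[0 in RHS](scale0r 0) bilZr mul0r.
by rewrite !big_cons bilDr bilZr IH.
Qed.

Lemma bil_refl s x y : s \in J -> inV A x -> bil (refl s x) (refl s y) = bil x y.
Proof.
move=> sJ hx; rewrite /refl -!scaleNr !(bilDl, bilDr, bilZl, bilZr).
rewrite !bil_sroot_l// bil_sroot_r// pr_sroot (cartan_diag _ hWS); last exact: JS.
by ring.
Qed.

Lemma bil_rep g x y : gen_words A g -> inV A x -> bil (rep g x) (rep g y) = bil x y.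
Proof.
move=> [l lA <-] hx; rewrite !(rep_word hWS); try by move=> t /lA/set_mem/AS h0; apply: mem_set.
elim: l lA => //= s l IH /words_cons[sA lA]; rewrite bil_refl -?memA//; first exact: IH.
rewrite -(rep_word hWS); last by move=> t /lA/set_mem/AS h0; apply: mem_set.
by apply: (inV_rep hWS) => //; exists l.
Qed.

Lemma bil_root a : root_set A a -> bil a a = 2.
Proof.
move=> [g [s [gA sA ->]]]; rewrite bil_rep//; last exact: inV_sroot.
by rewrite bil_sroot_l -?memA// pr_sroot (cartan_diag _ hWS)//; apply: JS; rewrite -memA.
Qed.

Lemma root_reflection a : root_set A a -> exists2 r, gen_words A r &
  forall x, inV A x -> rep r x = x - bil x a *: a.
Proof.
move=> [g [s [gA sA ->]]]; have sJ : s \in J by rewrite -memA.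
have AI : involutive_set A by move=> r; rewrite memA => /JS /(coxeter_invol hWS).
exists (g * s * g^-1)%g.
  by apply: gen_wordsM; [apply: gen_wordsM => //; exact: gen_words_gen | exact: gen_wordsV].
move=> x hx; rewrite (repM hWS) (repM_gen hWS) /refl; last exact: JS.
rewrite repB repZ (repVK hWS) -bil_sroot_r//; last by apply: (inV_rep hWS) => //; exact: gen_wordsV.
rewrite -(@bil_rep g) ?(repVK hWS)//.
by apply: (inV_rep hWS) => //; exact: gen_wordsV.
Qed.

Lemma rep_expS u n x : rep (u ^+ n.+1)%g x = rep u (rep (u ^+ n)%g x).
Proof. by rewrite expgS (repM hWS). Qed.

Lemma rep_expSr u n x : rep (u ^+ n.+1)%g x = rep (u ^+ n)%g (rep u x).
Proof. by rewrite expgSr (repM hWS). Qed.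

Lemma rotationE a b r1 r2 : root_set A a -> root_set A b ->
  (forall x, inV A x -> rep r1 x = x - bil x a *: a) ->
  (forall x, inV A x -> rep r2 x = x - bil x b *: b) ->
  forall p q, rep (r1 * r2)%g (p *: a + q *: b) =
    ((bil a b ^+ 2 - 1) * p + bil a b * q) *: a + (- (bil a b * p + q)) *: b.
Proof.
move=> ra rb e1 e2 p q.
have ha := roots_inV hWS AS ra; have hb := roots_inV hWS AS rb.
have hpq p' q' : inV A (p' *: a + q' *: b) by apply: inVD; apply: inVZ.
rewrite (repM hWS) e2// bilDl !bilZl (bil_root rb).
have -> : p *: a + q *: b - (p * bil a b + q * 2) *: b =
    p *: a + (- (bil a b * p + q)) *: b.
  by apply/funext => z; rewrite !fctE /= /GRing.scale /=; ring.
rewrite e1// bilDl !bilZl (bil_root ra) (bil_sym hb ha).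
by apply/funext => z; rewrite !fctE /= /GRing.scale /=; ring.
Qed.

(** Cayley-Hamilton on the plane of [a] and [b]: with [c = bil a b] the rotation has determinant 1
    and trace [c^2 - 2]. *)
Lemma rotation_rec a b r1 r2 : root_set A a -> root_set A b ->
  (forall x, inV A x -> rep r1 x = x - bil x a *: a) ->
  (forall x, inV A x -> rep r2 x = x - bil x b *: b) ->
  forall p q i, let x := p *: a + q *: b in
  rep ((r1 * r2) ^+ i.+2)%g x =
    (bil a b ^+ 2 - 2) *: rep ((r1 * r2) ^+ i.+1)%g x - rep ((r1 * r2) ^+ i)%g x.
Proof.
move=> ra rb e1 e2 p q i x; have uE := rotationE ra rb e1 e2.
rewrite !rep_expSr -repZ -repB; congr rep; rewrite /x !uE.
by apply/funext => z; rewrite !fctE /= /GRing.scale /=; ring.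
Qed.

Lemma reflection_neg a r : root_set A a ->
  (forall x, inV A x -> rep r x = x - bil x a *: a) -> rep r a = - a.
Proof.
move=> ra e; rewrite e ?bil_root//; last exact: (roots_inV hWS AS ra).
by rewrite -[X in X - _]scale1r -scalerBl -[RHS]scaleN1r; congr (_ *: _); ring.
Qed.

Definition ht x : R := \sum_(t <- J) cf x t.

Lemma htD x y : ht (x + y) = ht x + ht y.
Proof. by rewrite /ht -big_split. Qed.

Lemma htZ c x : ht (c *: x) = c * ht x.
Proof. by rewrite /ht mulr_sumr. Qed.

Lemma ht0 : ht 0 = 0.
Proof. by rewrite /ht big1. Qed.

Lemma ht_sum (I : Type) (r : seq I) (F : I -> V) :
  ht (\sum_(i <- r) F i) = \sum_(i <- r) ht (F i).
Proof. exact: (big_morph ht htD ht0). Qed.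

Lemma ht_root_gt0 a : root_set A a -> posv a -> 0 < ht a.
Proof.
move=> ra pa; have ha := roots_inV hWS AS ra.
have : 0 <= ht a by apply: sumr_ge0 => t _; exact: pa.
rewrite le_eqVlt => /orP[|//]; rewrite eq_sym psumr_eq0; last by move=> t _; exact: pa.
move=> /allP /= h; case: (roots_not_both hWS (rootsS AS ra) pa) => t.
have [tJ|tJ] := boolP (t \in J); first by rewrite cfN (eqP (h t tJ)) oppr0.
by rewrite cfN (inV_cf0 ha) ?memA// oppr0.
Qed.

Lemma gen_wordsX u n : gen_words A u -> gen_words A (u ^+ n)%g.
Proof.
move=> hu; elim: n => [|n IH]; first by rewrite expg0; exact: gen_words1.
by rewrite expgS; exact: gen_wordsM.
Qed.

(* [u] makes only finitely many positive roots negative, so in an infinite orbit the sign is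
   eventually constant and the heights contradict [no_positive_recurrence]. *)
Lemma rotation_orbit_finite u x (t : R) : t < 2 -> gen_words A u -> root_set A x ->
  (forall i, rep (u ^+ i.+2)%g x = t *: rep (u ^+ i.+1)%g x - rep (u ^+ i)%g x) ->
  exists2 n, (0 < n)%N & rep (u ^+ n)%g x = x.
Proof.
move=> t2 uA rx xrec; pose X i := rep (u ^+ i)%g x.
have rX i : root_set A (X i) by apply: roots_rep => //; exact: gen_wordsX.
have [|nex] := pselect (exists i j, (i < j)%N /\ X i = X j).
  move=> [i [j [ij e]]]; exists (j - i)%N; first by rewrite subn_gt0.
  apply: (@rep_inj _ _ _ hWS (u ^+ i)%g).
  by rewrite -(repM hWS) -expgnDr subnKC ?(ltnW ij)// -[RHS]/(X i) e.
exfalso; have inj : injective X.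
  move=> i j e; have [ij|ij|//] := ssrnat.ltngtP i j.
    by case: nex; exists i, j.
  by case: nex; exists j, i.
have XS i : X i.+1 = rep u (X i) by exact: rep_expS.
(* The factor [e] treats both directions of a sign change at once: a bad index [i] gives the
   inversion [e *: X i] of [u], and distinct indices give distinct inversions. *)
have fin (e : R) : (e = 1 \/ e = -1) ->
    exists n, forall i, (n <= i)%N -> posv (e *: X i) -> posv (e *: X i.+1).
  move=> he; pose bad := [set i | posv (e *: X i) /\ posv (- (e *: X i.+1))].
  have reX i : root_set A (e *: X i).
    by case: he => ->; rewrite ?scale1r// scaleN1r; exact: rootsN.
  have : finite_set bad.
    have inje : injective (fun i => e *: X i).
      move=> i j; case: he => ->; rewrite ?scale1r ?scaleN1r; first exact: inj.
      by move/oppr_inj/inj.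
    apply: (@sub_finite_set _ _ ((fun i => e *: X i) @^-1` inversions S u)).
      move=> i [p1 p2]; split=> //; first exact: rootsS AS _ (reX i).
      by rewrite repZ -XS.
    by apply: finite_preimage (finite_inversions R hWS u) => i j _ _; exact: inje.
  move=> /finite_seqP[s es]; exists (\max_(i <- s) i)%N.+1 => i ni pi.
  case: (roots_sign hWS (rootsS AS (reX i.+1))) => // ngi.
  have si : i \in s by have : bad i by []; rewrite es.
  by move: ni; rewrite ltnNge (@leq_bigmax_seq _ _ xpredT id _ si).
suff [e [n [he pn]]] : exists e n, (e = 1 \/ e = -1 :> R) /\
    forall i, posv (e *: X (n + i)%N).
  apply: (@no_positive_recurrence _ (fun i => ht (e *: X (n + i)%N)) t t2) => i.
    apply: ht_root_gt0 => //.
    by case: he => ->; rewrite ?scale1r// scaleN1r; exact: rootsN.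
  rewrite !addnS /X xrec !htZ htD htZ -[- rep _ _]scaleN1r htZ; ring.
have [n1 h1] := fin 1 (or_introl erefl); have [n2 h2] := fin (-1) (or_intror erefl).
pose n := maxn n1 n2.
case: (roots_sign hWS (rootsS AS (rX n))) => pn.
  exists 1, n; split; first by left.
  elim=> [|i IH]; first by rewrite addn0 scale1r.
  by rewrite addnS; apply: h1 => //; rewrite (leq_trans (leq_maxl n1 n2))// leq_addr.
exists (-1), n; split; first by right.
elim=> [|i IH]; first by rewrite addn0 scaleN1r.
by rewrite addnS; apply: h2 => //; rewrite (leq_trans (leq_maxr n1 n2))// leq_addr.
Qed.


Lemma ht_rep_gt0 a g : root_set A a -> gen_words A g ->
  ~ inversions S g a -> posv a -> 0 < ht (rep g a).
Proof.
move=> ra gA ninv pa; apply: ht_root_gt0; first exact: roots_rep.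
have rga : root_set S (rep g a) by apply/(rootsS AS)/roots_rep.
by case: (roots_sign hWS rga) => // nga; case: ninv; split=> //; exact: rootsS AS _ ra.
Qed.

Implicit Types (f : V -> R).

Definition linfun f :=
  (forall x z, f (x + z) = f x + f z) /\ (forall c x, f (c *: x) = c * f x).

Lemma linfunN f x : linfun f -> f (- x) = - f x.
Proof. by move=> [_ hZ]; rewrite -scaleN1r hZ mulN1r. Qed.

Lemma linfun_sum f (r : seq W) (c : W -> R) : linfun f ->
  f (\sum_(t <- r) c t *: sroot t) = \sum_(t <- r) c t * f (sroot t).
Proof.
move=> [hD hZ]; elim: r => [|t r IH]; last by rewrite !big_cons hD hZ IH.
by rewrite !big_nil -[0 in LHS](scale0r 0) hZ mul0r.
Qed.

(* Averaging the height over the finite dihedral group generated by the two reflections. *)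
Lemma averaged_height a b : root_set A a -> root_set A b -> bil a b ^+ 2 < 4 ->
  exists f, [/\ linfun f, f a = 0, f b = 0 &
    finite_set [set x | [/\ root_set A x, posv x & f x <= 0]]].
Proof.
move=> ra rb c4; have ha := roots_inV hWS AS ra; have hb := roots_inV hWS AS rb.
have [r1 g1 e1] := root_reflection ra; have [r2 g2 e2] := root_reflection rb.
have r1a := reflection_neg ra e1; have r2b := reflection_neg rb e2.
pose u := (r1 * r2)%g; have uA : gen_words A u by exact: gen_wordsM.
pose c := bil a b; have urec := rotation_rec ra rb e1 e2.
have c2 : c ^+ 2 - 2 < 2 by rewrite ltrBlDr (_ : 2 + 2 = 4)//; ring.
have [n1 n10 un1] : exists2 n, (0 < n)%N & rep (u ^+ n)%g a = a.
  apply: (rotation_orbit_finite c2 uA ra) => i.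
  by have := urec 1 0 i; rewrite scale1r scale0r addr0.
have [n2 n20 un2] : exists2 n, (0 < n)%N & rep (u ^+ n)%g b = b.
  apply: (rotation_orbit_finite c2 uA rb) => i.
  by have := urec 0 1 i; rewrite scale1r scale0r add0r.
pose N := (n1 * n2)%N; have N0 : (0 < N)%N by rewrite muln_gt0 n10.
have iterfix g x m : rep g x = x -> rep (g ^+ m)%g x = x.
  by move=> h; elim: m => [|m IH]; rewrite ?expg0 ?(rep1 hWS)// rep_expS IH.
have uNa : rep (u ^+ N)%g a = a by rewrite /N expgnA iterfix.
have uNb : rep (u ^+ N)%g b = b by rewrite /N mulnC expgnA iterfix.
have uN1 : (u ^+ N = 1)%g.
  apply: (@parab_eq1 R _ _ hWS _ _ AS); first exact: gen_wordsX.
  move=> s sA; have hs := inV_sroot R sA; pose x := sroot s.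
  suff -> : rep (u ^+ N)%g x = x by exact: posv_sroot.
  (* The Gram determinant of [a] and [b] is nonzero, so [x] has an orthogonal projection to their
     plane, with coordinates [p] and [q]; the rest [z] is fixed by both reflections. *)
  pose d := 4 - c ^+ 2; have d0 : d != 0.
    by rewrite /d; apply: lt0r_neq0; rewrite subr_gt0.
  pose p := (2 * bil x a - c * bil x b) / d.
  pose q := (2 * bil x b - c * bil x a) / d.
  pose z := x - (p *: a + q *: b).
  have hz : inV A z by apply: inVB => //; apply: inVD; apply: inVZ.
  have za : bil z a = 0.
    rewrite /z bilDl bilNl bilDl !bilZl (bil_root ra) (bil_sym hb ha) -/c /p /q.
    by rewrite /d in d0 *; field.
  have zb : bil z b = 0.
    rewrite /z bilDl bilNl bilDl !bilZl (bil_root rb) -/c /p /q.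
    by rewrite /d in d0 *; field.
  have uz : rep u z = z by rewrite /u (repM hWS) e2// zb scale0r subr0 e1// za scale0r subr0.
  have -> : x = z + (p *: a + q *: b) by rewrite subrK.
  by rewrite repD (iterfix _ _ _ uz) repD !repZ uNa uNb.
pose q z := \sum_(0 <= i < N) ht (rep (u ^+ i)%g z).
have qD x z : q (x + z) = q x + q z.
  by rewrite /q -big_split; apply: eq_bigr => i _; rewrite repD htD.
have qZ d x : q (d *: x) = d * q x.
  by rewrite /q mulr_sumr; apply: eq_bigr => i _; rewrite repZ htZ.
have qN x : q (- x) = - q x by rewrite -scaleN1r qZ mulN1r.
have qu z : q (rep u z) = q z.
  rewrite /q -(prednK N0) big_nat_recr//= big_nat_recl//= addrC; congr (_ + _).
    by rewrite -rep_expSr prednK// uN1 expg0.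
  by apply: eq_bigr => i _; rewrite rep_expSr.
(* The sum runs over the rotations [u^i] and the reflections [u^i r1]. It vanishes on [a] and [b]
   because [r1 a = - a], [r1 b = - u b] and [q] is invariant under [u]. *)
exists (fun x => q x + q (rep r1 x)); split.
- split=> [x z|d x]; first by rewrite repD !qD addrACA.
  by rewrite repZ !qZ mulrDr.
- by rewrite r1a qN subrr.
- have -> : rep r1 b = - rep u b by rewrite /u (repM hWS) r2b repN opprK.
  by rewrite qN qu subrr.
pose bad i := inversions S (u ^+ i)%g `|` inversions S (u ^+ i * r1)%g : set V.
apply: (@sub_finite_set _ _ (\bigcup_(i in `I_N) bad i)); last first.
  apply: bigcup_finite; first exact: finite_II.
  by move=> i _; rewrite finite_setU; split; exact: finite_inversions.
move=> x [rx px yx]; apply: contrapT => nx.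
suff : 0 < q x + q (rep r1 x) by rewrite ltNge yx.
have sum_gt0 (F : nat -> R) : (forall i, (i < N)%N -> 0 < F i) ->
    0 < \sum_(0 <= i < N) F i.
  move=> hF; rewrite -(prednK N0) big_nat_recr//= ltr_wpDl ?hF ?prednK//.
  by rewrite big_nat; apply: sumr_ge0 => i /= iN; rewrite ltW// hF// -(prednK N0) ltnW.
rewrite addr_gt0//; apply: sum_gt0 => i iN.
  apply: ht_rep_gt0 => //; first exact: gen_wordsX.
  by move=> inv; apply: nx; exists i => //; left.
rewrite -(repM hWS); apply: ht_rep_gt0 => //; first by apply: gen_wordsM => //; exact: gen_wordsX.
by move=> inv; apply: nx; exists i => //; right.
Qed.


(** Reflecting in a simple root on which [f] is negative removes it from the finite list of positive
    roots with negative value and permutes the other positive roots, so the list gets shorter. *)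
Lemma dominant_conjugate f : linfun f ->
  finite_set [set x | [/\ root_set A x, posv x & f x <= 0]] ->
  exists2 h, gen_words A h &
    (forall s, s \in J -> 0 <= f (rep h^-1%g (sroot s))) /\
    finite_set [set x | [/\ root_set A x, posv x & f (rep h^-1%g x) <= 0]].
Proof.
move=> lf fin.
have [l hl] : exists l : seq V, forall x, root_set A x -> posv x -> f x < 0 -> x \in l.
  have /finite_seqP[l el] := fin; exists l => x rx px fx.
  by have : [set` l] x by rewrite -el; split=> //; exact: ltW.
have [n] := ubnP (size l); elim: n l f lf fin hl => // n IH l f lf fin hl /ltnSE ln.
have [[s [sJ fs]]|dom] := pselect (exists s, s \in J /\ f (sroot s) < 0); last first.
  exists 1%g; first exact: gen_words1.
  rewrite invg1; split=> [s sJ|].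
    by rewrite (rep1 hWS) leNgt; apply/negP => fs; apply: dom; exists s.
  by apply: sub_finite_set fin => x [rx px]; rewrite (rep1 hWS).
have sS := JS sJ; have sA : s \in A by rewrite memA.
have refl_root x : root_set A x -> root_set A (refl s x).
  by move=> rx; rewrite -(rep_gen hWS)//; apply: roots_rep => //; exact: gen_words_gen.
have sgn x : root_set A x -> posv x ->
    x = sroot s \/ posv (refl s x) /\ refl s x != sroot s.
  move=> rx px; case: (roots_sign hWS (rootsS AS (refl_root x rx))) => px'.
    right; split=> //; apply/eqP => e.
    have ex : x = - sroot s by rewrite -(reflK hWS x sS) e (refl_sroot _ hWS).
    apply: (roots_not_both hWS (rootsS AS rx) px); rewrite ex opprK.
    exact: posv_sroot.
  by left; apply: (roots_simple hWS sS (rootsS AS rx)).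
pose f' x := f (refl s x).
have lf' : linfun f'.
  case: lf => fD fZ; split=> [x z|c x]; first by rewrite /f' reflD fD.
  by rewrite /f' reflZ fZ.
have fss : f' (sroot s) = - f (sroot s) by rewrite /f' (refl_sroot _ hWS)// linfunN.
have [|||h hA [dom fin']] := IH [seq refl s x | x <- rem (sroot s) l] f' lf'.
- apply: (@sub_finite_set _ _ ([set sroot s] `|`
      refl s @` [set x | [/\ root_set A x, posv x & f x <= 0]])).
    move=> x [rx px fx]; case: (sgn x rx px) => [->|[px' _]]; first by left.
    right; exists (refl s x); last by rewrite (reflK hWS).
    by split=> //; exact: refl_root.
  by rewrite finite_setU; split; [exact: finite_set1 | exact: finite_image].
- move=> x rx px fx; case: (sgn x rx px) => [ex|[px' nx]].
    by move: fx; rewrite ex fss oppr_lt0 ltNge (ltW fs).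
  have xl := hl _ (refl_root _ rx) px' fx.
  apply/mapP; exists (refl s x); last by rewrite (reflK hWS).
  have sl : sroot s \in l by apply: hl => //; exact: (roots_sroot R hWS).
  by move: xl; rewrite (perm_mem (perm_to_rem sl)) in_cons (negPf nx).
- have sl : sroot s \in l by apply: hl => //; exact: (roots_sroot R hWS).
  by rewrite size_map size_rem//; move: ln sl; case: (l).
have e x : rep (h * s)^-1%g x = refl s (rep h^-1%g x).
  by rewrite invgM (invg_involution (coxeter_invol hWS) sS) (repM hWS) (rep_gen hWS).
exists (h * s)%g; first by apply: gen_wordsM => //; exact: gen_words_gen.
split=> [t tJ|]; first by rewrite e; exact: dom.
by apply: sub_finite_set fin' => x [rx px]; rewrite e.
Qed.

(** [L] selects the simple roots killed by the dominant functional. A positive root on which it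
    vanishes involves only these, and only finitely many positive roots have value at most 0. *)
Lemma dihedral_in_finite_parabolic a b :
  root_set A a -> root_set A b -> bil a b ^+ 2 < 4 ->
  exists h (L : pred W), [/\ gen_words A h,
    inV [set` [seq t <- J | L t]] (rep h a), inV [set` [seq t <- J | L t]] (rep h b) &
    finite_set [set x | root_set A x /\ inV [set` [seq t <- J | L t]] x]].
Proof.
move=> ra rb c4; have [f [lf fa fb fin]] := averaged_height ra rb c4.
have [h hA [dom fin']] := dominant_conjugate lf fin.
pose f' x := f (rep h^-1%g x).
have lf' : linfun f'.
  case: lf => fD fZ; split=> [x z|c x]; first by rewrite /f' repD fD.
  by rewrite /f' repZ fZ.
pose L t := f' (sroot t) == 0.
have memL t : (t \in [set` [seq t <- J | L t]]) = (t \in J) && L t.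
  by rewrite mem_setE mem_filter andbC.
have f'L x : inV [set` [seq t <- J | L t]] x -> f' x = 0.
  move=> [l [_ lL ->]]; rewrite linfun_sum// big_seq big1// => t /lL.
  by rewrite memL => /andP[_ /eqP ->]; rewrite mulr0.
have posL x : root_set A x -> posv x -> f' x = 0 -> inV [set` [seq t <- J | L t]] x.
  move=> rx px fx; have hx := roots_inV hWS AS rx.
  apply: (inV_restrict hx) => t; rewrite memA => tJ; rewrite memL tJ => /= nL.
  have /eqP := fx; rewrite {1}(inV_seq hx) linfun_sum// big_seq.
  rewrite psumr_eq0; last by move=> r rJ; rewrite mulr_ge0 ?px// dom.
  by move=> /allP /(_ t tJ); rewrite tJ mulf_eq0 -/(L t) (negPf nL) orbF => /eqP.
have inL x : root_set A x -> f' x = 0 -> inV [set` [seq t <- J | L t]] x.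
  move=> rx fx; case: (roots_sign hWS (rootsS AS rx)) => px; first exact: posL.
  by rewrite -[x]opprK; apply/inVN/posL; rewrite ?linfunN ?fx ?oppr0//; exact: rootsN.
exists h, L; split=> //.
- by apply: inL; [exact: roots_rep | rewrite /f' (repK hWS)].
- by apply: inL; [exact: roots_rep | rewrite /f' (repK hWS)].
pose fin0 := [set x | [/\ root_set A x, posv x & f' x <= 0]].
apply: (@sub_finite_set _ _ (fin0 `|` -%R @` fin0)); last first.
  by rewrite finite_setU; split; [|apply: finite_image]; exact: fin'.
move=> x [rx hx]; case: (roots_sign hWS (rootsS AS rx)) => px.
  by left; split=> //; rewrite f'L.
right; exists (- x); last by rewrite opprK.
by split=> //; [exact: rootsN | rewrite linfunN// f'L// oppr0].
Qed.

(** The form is invariant under conjugation, and a finite [J] has finitely many subsets, coded by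
    boolean masks; those with infinitely many roots contribute no values. *)
Lemma finite_bil_values :
  finite_set [set c | exists a b, [/\ root_set A a, root_set A b, c = bil a b & c ^+ 2 < 4]].
Proof.
pose PhiL (l : seq W) := [set x | root_set A x /\ inV [set` l] x].
pose vals (m : (size J).-tuple bool) : set R :=
  if pselect (finite_set (PhiL (mask m J))) then
    [set bil x z | x in PhiL (mask m J) & z in PhiL (mask m J)] else set0.
apply: (@sub_finite_set _ _ (\bigcup_(m in setT) vals m)); last first.
  apply: bigcup_finite; first exact: finite_finset.
  move=> m _; rewrite /vals; case: pselect => h; last exact: finite_set0.
  exact: finite_image2.
move=> _ [a [b [ra rb -> c4]]].
have [h [L [hA ha hb fin]]] := dihedral_in_finite_parabolic ra rb c4.
exists [tuple of map L (in_tuple J)] => //; rewrite /vals /= -filter_mask.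
case: pselect => [h1|/(_ fin)//].
exists (rep h a); first by split=> //; exact: roots_rep.
exists (rep h b); first by split=> //; exact: roots_rep.
by rewrite bil_rep//; exact: (roots_inV hWS AS ra).
Qed.

End FiniteRank.



(** * Ramsey's theorem for pairs *)

Section Ramsey.
Variables (X C : choiceType) (col : X -> X -> C) (F : seq C).

(** Each chosen point carries the colour that it has with all later ones, found by the pigeonhole
    principle on the infinite set that remains. Pairs are ordered, as [col] need not be
    symmetric. *)
Lemma ramsey_chain (P : set X) k : infinite_set P ->
  (forall x y, P x -> P y -> x != y -> col x y \in F) ->
  exists l : seq (X * C), [/\ size l = k, forall p, p \in l -> P p.1 /\ p.2 \in F &
    pairwise (fun p q => (p.1 != q.1) && (col p.1 q.1 == p.2)) l].
Proof.
elim: k P => [|k IH] P infP colF; first by exists [::].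
have [x Px] := infinite_setN0 infP.
pose Q c := [set y | [/\ P y, x != y & col x y = c]].
have [c cF infQ] : exists2 c, c \in F & infinite_set (Q c).
  apply: contrapT => nex; apply: infP.
  apply: (@sub_finite_set _ _ ([set x] `|` \bigcup_(c in [set` F]) Q c)).
    move=> y Py; have [<-|xy] := eqVneq x y; first by left.
    by right; exists (col x y) => //=; exact: colF.
  rewrite finite_setU; split; first exact: finite_set1.
  apply: bigcup_finite; first exact: finite_seq.
  by move=> c /= cF; apply: contrapT => infQ; apply: nex; exists c.
have [l [sl lP pl]] := IH _ infQ (fun y z Qy Qz => colF y z (let: And3 p _ _ := Qy in p) (let: And3 p _ _ := Qz in p)).
exists ((x, c) :: l); split=> /=; first by rewrite sl.
  by move=> p; rewrite in_cons => /orP[/eqP->//|/lP[[]]].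
rewrite pl andbT; apply/allP => p /lP[[_ /= -> ->] _]; exact: eqxx.
Qed.

Lemma ramsey (P : set X) n : infinite_set P ->
  (forall x y, P x -> P y -> x != y -> col x y \in F) ->
  exists l c, [/\ size l = n, uniq l, forall x, x \in l -> P x, c \in F &
    pairwise (fun x y => col x y == c) l].
Proof.
case: n => [|n] infP colF.
  (* Even for the empty list a colour in [F] must be given, hence two distinct points. *)
  have [x Px] := infinite_setN0 infP.
  have [y [Py xy]] : (P `\ x) !=set0 by apply/infinite_setN0/infinite_setD.
  exists [::], (col x y); split=> //; apply: colF => //.
  by apply/eqP => e; apply: xy.
(* With more than [n * size F] points some colour is carried by at least [n.+1] of them. *)
have [l [sl lP pl]] := @ramsey_chain P (n * size F).+1 infP colF.
have [c cF cn] : exists2 c, c \in F & (n < count (fun p : X * C => p.2 == c) l)%N.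
  apply: contrapT => nex.
  have le c : c \in F -> (count (fun p : X * C => p.2 == c) l <= n)%N.
    by move=> cF; rewrite leqNgt; apply/negP => h; apply: nex; exists c.
  have : (size l <= \sum_(c <- F) count (fun p : X * C => p.2 == c) l)%N.
    under eq_bigr do rewrite -sum1_count big_mkcond.
    rewrite exchange_big -sum1_size big_seq [X in (_ <= X)%N]big_seq.
    apply: leq_sum => p /lP[_ pF] /=.
    by rewrite (big_rem p.2)//= eqxx.
  have : (\sum_(c <- F) count (fun p : X * C => p.2 == c) l <= n * size F)%N.
    rewrite big_seq -sum1_size big_distrr /= [X in (_ <= X)%N]big_seq.
    by apply: leq_sum => c /le; rewrite muln1.
  by rewrite sl; move=> h1 h2; have := leq_trans h2 h1; rewrite ltnn.
pose l' := [seq p <- l | p.2 == c]; exists (take n.+1 (map fst l')), c.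
have pl' : pairwise (fun p q : X * C => (p.1 != q.1) && (col p.1 q.1 == c)) l'.
  have : pairwise (fun p q : X * C => (p.1 != q.1) && (col p.1 q.1 == p.2)) l'.
    exact: pairwise_filter.
  apply: (@sub_in_pairwise _ [pred p : X * C | p.2 == c]); last exact: filter_all.
  by move=> p q /= /eqP <- _.
have pm : pairwise (fun x y => (x != y) && (col x y == c)) (map fst l').
  by rewrite pairwise_map.
have {}pm : pairwise (fun x y => (x != y) && (col x y == c)) (take n.+1 (map fst l')).
  by apply: subseq_pairwise pm; exact: take_subseq.
split=> //.
- by rewrite size_takel// size_map size_filter.
- by rewrite uniq_pairwise; apply: sub_pairwise pm => x y /andP[].
- by move=> x /mem_take /mapP[p]; rewrite mem_filter => /andP[_ /lP[pP _]] ->.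
- by apply: sub_pairwise pm => x y /andP[].
Qed.

End Ramsey.

(** * A pair of roots with large product in an infinite parabolic subgroup *)

Section InfiniteParabolic.
Variables (R : realType) (W : groupType) (S : set W) (hWS : coxeter_system S).
Variables (J : seq W) (uJ : uniq J) (JS : {subset J <= S}).
Implicit Types (s t w g h u : W) (l : seq W).
Local Notation V := (W * bool -> R^o).
Implicit Types (x y z a b : V).
Local Notation sroot := (sroot R).
Local Notation rep := (rep S).
Local Notation root_set := (@root_set R W S).
Local Notation A := [set` J].
Local Notation bil := (bil J).

Let AS : A `<=` S.
Proof. by move=> s /JS /set_mem. Qed.

Let memA s : (s \in A) = (s \in J).
Proof. by rewrite mem_setE. Qed.

Lemma linear_dependence (l : seq V) : (size J < size l)%N ->
  (forall x, x \in l -> inV A x) ->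
  exists2 c : 'I_(size l) -> R, (exists i, c i != 0) &
    \sum_i c i *: l`_i = 0.
Proof.
move=> sl hl; pose M := \matrix_(i < size l, j < size J) cf (l`_i) (nth 1%g J j).
have : kermx M != 0.
  by rewrite kermx_eq0 -row_leq_rank -ltnNge (leq_ltn_trans (rank_leq_col _)).
move=> /matrix0Pn[i0 [j0 nz]]; pose v := row i0 (kermx M).
exists (v 0); first by exists j0; rewrite mxE.
have vM : v *m M = 0 by apply/sub_kermxP; exact: row_sub.
have hli i : i \in enum 'I_(size l) -> inV A (v 0 i *: l`_i).
  by move=> _; apply/inVZ/hl/mem_nth.
have hsum : inV A (\sum_i v 0 i *: l`_i).
  by rewrite -big_enum; exact: inV_sum.
apply: (inV_eq hsum (inV0 _ _)) => t; rewrite cf0.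
have [tJ|tJ] := boolP (t \in J); last by rewrite (inV_cf0 hsum)// memA.
have := congr1 (fun B : 'rV_(size J) => B 0 (Ordinal (etrans (index_mem t J) tJ))) vM.
rewrite !mxE => <-; rewrite cf_sum; apply: eq_bigr => i _.
by rewrite cfZ [M _ _]mxE /= nth_index.
Qed.

(* If all [|bil a b| < 2], Ramsey gives more than [size J] positive roots with constant
   pairwise product; in a linear relation between them all coefficients agree. *)
Lemma exists_big_pair : infinite_set (gen_words A) ->
  exists a b, [/\ root_set A a, root_set A b, b <> a, b <> - a & 4 <= bil a b ^+ 2].
Proof.
move=> infA; apply: contrapT => nex.
have small a b : root_set A a -> root_set A b -> b <> a -> b <> - a -> bil a b ^+ 2 < 4.
  move=> ra rb ba bna; rewrite ltNge; apply/negP => h; apply: nex.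
  by exists a, b.
pose P := [set x | root_set A x /\ posv x].
have infP : infinite_set P by move=> fP; apply: infA; exact: (@finite_pos_roots R _ _ hWS _ AS).
have smallP x y : P x -> P y -> x != y -> bil x y ^+ 2 < 4.
  move=> [rx px] [ry py] xy; apply: (small _ _ rx ry) => e.
    by move: xy; rewrite e eqxx.
  by apply: (roots_not_both hWS (rootsS AS rx) px); rewrite -e.
have /finite_seqP[F eF] := finite_bil_values R hWS uJ JS.
have colF x y : P x -> P y -> x != y -> bil x y \in F.
  move=> Px Py xy; have : [set` F] (bil x y); last by [].
  rewrite -eF; exists x, y; split; [by case: Px | by case: Py | by [] | exact: smallP].
have [l [c [sl ul lP cF pl]]] := ramsey (size J).+1 infP colF.
have hl x : x \in l -> inV A x by move=> /lP[rx _]; exact: (roots_inV hWS AS rx).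
have [|k [i0 ki0] ek] := @linear_dependence l _ hl; first by rewrite sl.
have ln (i : 'I_(size l)) : l`_i \in l by exact: mem_nth.
have bilc (i j : 'I_(size l)) : i != j -> bil l`_i l`_j = c.
  wlog ij : i j / (i < j)%N.
    move=> H ij; have [lt|lt|e] := ssrnat.ltngtP i j; first exact: H.
      rewrite (bil_sym hWS uJ JS (hl _ (ln i)) (hl _ (ln j))); apply: (H _ _ lt).
      by rewrite eq_sym.
    by case/eqP: ij; exact: val_inj.
  move=> _; have /(pairwiseP 0) := pl => /(_ i j); rewrite !inE !ltn_ord.
  by move=> /(_ isT isT ij)/eqP.
have c2 : c < 2.
  have l1 : (1 < size l)%N.
    rewrite sl ltnS lt0n; apply/eqP => /size0nil J0.
    apply: infA; apply: (@sub_finite_set _ _ [set 1%g]); last exact: finite_set1.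
    move=> _ [[|s l0] l0A <-]; first by rewrite prodw_nil.
    by have := l0A s (mem_head _ _); rewrite memA J0.
  pose i : 'I_(size l) := Ordinal (ltnW l1); pose j : 'I_(size l) := Ordinal l1.
  rewrite -(@bilc i j isT); have : l`_i != l`_j by rewrite nth_uniq.
  move=> /(smallP _ _ (lP _ (ln i)) (lP _ (ln j))) h.
  by rewrite ltNge; apply/negP => h2; move: h; rewrite ltNge; case/negP; nra.
clear infA nex small smallP colF eF cF pl; pose T := \sum_i k i.
(* Pairing the relation with the [j]-th root gives [2 * k j + c * (T - k j) = 0]. *)
have kE j : (2 - c) * k j = - (c * T).
  have : bil (\sum_i k i *: l`_i) l`_j = 0.
    by rewrite ek bil0l.
  have -> : bil (\sum_i k i *: l`_i) l`_j = \sum_i k i * bil l`_i l`_j.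
    by rewrite bil_suml; apply: eq_bigr => i _; rewrite bilZl.
  have -> : T = k j + \sum_(i < size l | i != j) k i by rewrite /T (bigD1 j).
  rewrite (bigD1 j)//= (bil_root hWS uJ JS (proj1 (lP _ (ln j)))).
  have -> : \sum_(i < size l | i != j) k i * bil l`_i l`_j = c * \sum_(i < size l | i != j) k i.
    by rewrite mulr_sumr; apply: eq_bigr => i ij; rewrite bilc// mulrC.
  by move=> h; rewrite mulrDr; apply/eqP; rewrite -subr_eq0; apply/eqP; rewrite -[RHS]h; ring.
have keq j : k j = k i0.
  have d0 : 2 - c != 0 by rewrite gt_eqF// subr_gt0.
  by apply: (mulfI d0); rewrite !kE.
(* With all coefficients equal and nonzero, the relation says that a nonempty sum of positive
   heights is 0. *)
have : ht J (\sum_i k i *: l`_i) = 0.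
  by rewrite ek ht0.
have -> : ht J (\sum_i k i *: l`_i) = k i0 * \sum_(i < size l) ht J l`_i.
  by rewrite ht_sum mulr_sumr; apply: eq_bigr => i _; rewrite htZ keq.
move/eqP; rewrite mulf_eq0 (negPf ki0) /= (bigD1 i0)//= gt_eqF// ltr_pwDl//.
  by have [] := lP _ (ln i0); exact: (ht_root_gt0 hWS JS).
apply: sumr_ge0 => i _; rewrite ltW//.
by have [] := lP _ (ln i); exact: (ht_root_gt0 hWS JS).
Qed.

End InfiniteParabolic.



(** * Elements normalising an infinite parabolic subgroup up to powers *)

Section PeriodicSequence.
Variables (R : realType) (X : nat -> R) (t : R) (n : nat).
Hypotheses (n0 : (0 < n)%N) (Xn : forall i, X (i + n)%N = X i).
Hypothesis Xrec : forall i, X i.+2 = t * X i.+1 - X i.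

(** For [t = 2] the solutions are arithmetic progressions. *)
Lemma periodic_rec_eq2 : t = 2 -> X 1%N = X 0%N.
Proof.
move=> t2; have h i : X i = X 0%N + i%:R * (X 1%N - X 0%N) /\
    X i.+1 = X 0%N + i.+1%:R * (X 1%N - X 0%N).
  elim: i => [|i [IH1 IH2]]; first by split; ring.
  by split=> //; rewrite Xrec IH1 IH2 t2 -!natr1; ring.
have := Xn 0; rewrite add0n (h n).1 => /eqP.
rewrite -subr_eq0 [X in X == _](_ : _ = n%:R * (X 1%N - X 0%N)); last by ring.
by rewrite mulf_eq0 pnatr_eq0 (gtn_eqF n0) /= subr_eq0 => /eqP.
Qed.

(** Where [|X|] is maximal, [t * X] is the sum of its two neighbours and thus at most [2 * |X|] in
    absolute value. *)
Lemma periodic_rec_gt2 : 2 < t -> X 0%N = 0.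
Proof.
move=> t2; have [i0 hi0] : exists i0, forall i, `|X i| <= `|X i0|.
  have [i0 hi0] : exists i0, forall i, (i < n)%N -> `|X i| <= `|X i0|.
    elim: (n) => [|m [i0 hi0]]; first by exists 0%N.
    have [h|h] := lerP `|X m| `|X i0|.
      by exists i0 => i; rewrite ltnS leq_eqVlt => /orP[/eqP->//|/hi0].
    exists m => i; rewrite ltnS leq_eqVlt => /orP[/eqP->//|/hi0 h'].
    exact: le_trans h' (ltW h).
  exists i0 => i; have Xmod q r : X (q * n + r)%N = X r.
    by elim: q => // q IH; rewrite mulSnr addnAC Xn IH.
  by rewrite (divn_eq i n) Xmod; apply: hi0; rewrite ltn_mod.
(* The maximum is read one period later, so that a preceding index exists. *)
have e : t * X (i0 + n)%N = X (i0 + n).+1 + X (i0 + n).-1.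
  by rewrite -(prednK n0) addnS /= Xrec; ring.
have M0 : `|X i0| <= 0.
  have : `|t * X i0| <= `|X i0| + `|X i0|.
    by rewrite -{1}(Xn i0) e (le_trans (ler_normD _ _))// lerD.
  rewrite normrM gtr0_norm ?(lt_trans _ t2)// => h.
  rewrite leNgt; apply/negP => h0.
  have : 2 * `|X i0| < t * `|X i0| by rewrite ltr_pM2r.
  by rewrite ltNge mulr_natl mulr2n h.
by apply/eqP; rewrite -normr_le0 (le_trans (hi0 0%N)).
Qed.

End PeriodicSequence.

Section Normalizer.
Variables (R : realType) (W : groupType) (S : set W) (hWS : coxeter_system S).
Variables (J : seq W) (uJ : uniq J) (JS : {subset J <= S}).
Implicit Types (K : set W) (s t w g h u v : W) (l : seq W).
Local Notation V := (W * bool -> R^o).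
Implicit Types (x y z a b e : V).
Local Notation sroot := (sroot R).
Local Notation rep := (rep S).
Local Notation root_set := (@root_set R W S).
Local Notation A := [set` J].
Local Notation bil := (bil J).
Local Notation len := (coxeter_length S).

Let AS : A `<=` S.
Proof. by move=> s /JS /set_mem. Qed.

Let memA s : (s \in A) = (s \in J).
Proof. by rewrite mem_setE. Qed.

Let AI : involutive_set A.
Proof. by move=> r; rewrite memA => /JS /(coxeter_invol hWS). Qed.

(** Connectedness of [J] as an induction principle along its edges. *)
Definition coxeter_connected := forall X : set W, (exists2 s, s \in J & X s) ->
  (forall s t, s \in J -> t \in J -> X s -> coxeter_edge S s t -> X t) ->
  forall s, s \in J -> X s.

Hypothesis conn : coxeter_connected.

(** If [(x, s)] is nonzero, [x - refl s x] is a nonzero multiple of the root of [s]; membership in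
    [M] then spreads along edges. *)
Lemma stable_subspace (M : V -> Prop) :
  (forall x y, M x -> M y -> M (x + y)) -> (forall c x, M x -> M (c *: x)) ->
  (forall s x, s \in J -> M x -> M (refl s x)) ->
  forall x s, s \in J -> M x -> pr x s != 0 -> forall t, t \in J -> M (sroot t).
Proof.
move=> MD MZ MR x s sJ Mx xs.
have key r z : r \in J -> M z -> pr z r != 0 -> M (sroot r).
  move=> rJ Mz zr; suff -> : sroot r = (pr z r)^-1 *: (z + (-1) *: refl r z).
    by apply/MZ/MD => //; apply/MZ/MR.
  by rewrite scaleN1r /refl opprB addrC subrK scalerA mulVf// scale1r.
apply: (conn (X := fun t => M (sroot t))); first by exists s => //; exact: key xs.
move=> r t rJ tJ Mr rt; apply: key tJ Mr _.
by rewrite pr_sroot lt_eqF// (cartan_edge _ rt).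
Qed.

Lemma exists_min_coset w : exists2 g, gen_words A g &
  forall s, s \in J -> posv (rep (w * g)%g (sroot s)).
Proof.
have [n] := ubnP (len w); elim: n w => // n IH w /ltnSE wn.
have [[s [sJ ws]]|no] := pselect (exists s, s \in J /\ posv (- rep w (sroot s))).
  have e := neg_descent hWS (JS sJ) ws.
  have [|g gA hg] := IH (w * s)%g; first by rewrite -e.
  exists (s * g)%g; last by move=> t tJ; rewrite mulgA; exact: hg.
  by apply: gen_wordsM => //; apply: gen_words_gen; rewrite memA.
exists 1%g => [|s sJ]; first exact: gen_words1.
rewrite mulg1; case: (root_sign R hWS w (JS sJ)) => // ws.
by case: no; exists s.
Qed.

(** At a vertex with coefficient 0 the product with [e] is a sum of nonpositive terms. As it is 0,
    every neighbour has coefficient 0 too. *)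
Lemma null_vector_full_support e : inV A e -> posv e -> e <> 0 ->
  (forall s, s \in J -> pr e s = 0) -> forall s, s \in J -> 0 < cf e s.
Proof.
move=> he pe e0 null; apply: (conn (X := fun s => 0 < cf e s)).
  apply: contrapT => nex; apply: e0; apply: (inV_eq he (inV0 _ _)) => t.
  rewrite cf0; have [tJ|tJ] := boolP (t \in J); last by rewrite (inV_cf0 he)// memA.
  by apply/eqP; rewrite eq_le pe andbT leNgt; apply/negP => h; apply: nex; exists t.
move=> s t sJ tJ es st; rewrite lt_neqAle pe andbT eq_sym; apply/eqP => et.
pose B := A `\ t; have BS : B `<=` S by move=> r [/AS].
have tB : t \notin B by apply/negP => /set_mem[_]; exact.
have hB : inV B e.
  apply: (inV_restrict he) => r rA rB; have [->//|rt] := eqVneq r t.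
  by case/negP: rB; apply/mem_set; split; [exact: set_mem | exact/eqP].
have /eqP := pr_pos_eq0 hWS BS (JS tJ) tB hB pe (null t tJ) s.
by rewrite mulf_eq0 (gt_eqF es) lt_eqF// (cartan_edge _ st).
Qed.

(* For [r] outside [K], the [r]-coordinates of the vectors [v g u^i a], with [u] the product
   of the two reflections, form a periodic solution of [x'' = (c^2 - 2) x' - x], which forces
   [v g e] into [V_K] for a fixed nonzero [e]. The [W_J]-span of [e] is [V_J] unless [e]
   is orthogonal to [J]; then [e] has full support and fixed sign, and a minimal
   representative of [v W_J] maps the simple roots of [J] to positive vectors with positive
   combination in [V_K]. *)
Lemma power_conj_subspace K v : infinite_set (gen_words A) -> K `<=` S ->
  (forall u, gen_words A u -> exists2 n, (0 < n)%N & gen_words K (v * u ^+ n * v^-1)%g) ->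
  forall s, s \in J -> inV K (rep v (sroot s)).
Proof.
move=> /(exists_big_pair R hWS uJ JS)[a [b [ra rb ba bna c4]]] KS hv.
have ha := roots_inV hWS AS ra; have hb := roots_inV hWS AS rb.
have [r1 g1 e1] := root_reflection hWS uJ JS ra.
have [r2 g2 e2] := root_reflection hWS uJ JS rb.
pose u := (r1 * r2)%g; have uA : gen_words A u by exact: gen_wordsM.
pose c := bil a b.
have uE := rotationE hWS uJ JS ra rb e1 e2.
have urec := rotation_rec hWS uJ JS ra rb e1 e2.
have ua : rep u a - a = (c ^+ 2 - 2) *: a - c *: b.
  have := uE 1 0; rewrite scale1r scale0r addr0 => ->.
  by apply/funext => p; rewrite !fctE /= /GRing.scale /=; rewrite -/c; ring.
(* For [c^2 = 4] the periodic coordinates are only constant, so a difference is taken; for [c^2 > 4]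
   they vanish and [a] itself serves. *)
pose e := if c ^+ 2 == 4 then rep u a - a else a.
have he : inV A e.
  by rewrite /e; case: ifP => // _; apply: inVB => //; exact: inV_rep.
have e0 : e <> 0.
  rewrite /e ua; case: ifP => [/eqP c4'|_ a0]; last first.
    by have := bil_root hWS uJ JS ra; rewrite a0 bil0l; lra.
  rewrite c4' => h; have : (c - 2) * (c + 2) = 0 by rewrite -subr_sqr c4'; ring.
  have {}h : 2 *: a = c *: b.
    by apply/eqP; rewrite -subr_eq0 -[X in _ == X]h; apply/eqP; congr (_ *: _ - _); ring.
  have halfK z : 2^-1 *: (2 *: z) = z by rewrite scalerA mulVf ?scale1r ?pnatr_eq0.
  move/eqP; rewrite mulf_eq0 subr_eq0 addr_eq0 => /orP[]/eqP ec.
    by apply: ba; rewrite -(halfK a) h ec halfK.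
  by apply: bna; rewrite -(halfK a) h ec scaleNr scalerN halfK opprK.
have hvKe g : gen_words A g -> inV K (rep (v * g)%g e).
  move=> gA; have hS : inV S (rep (v * g)%g e).
    by apply: (inV_repS hWS); exact: inVS AS he.
  apply: (inV_restrict hS) => r rS rK.
  (* The power obtained lies in [W_K] after conjugation, so it does not change the [r]-coordinate:
     [X] has period [n]. *)
  have [n n0 hk] := hv (g * u * g^-1)%g (gen_wordsM (gen_wordsM gA uA) (gen_wordsV AI gA)).
  pose X i := cf (rep (v * g)%g (rep (u ^+ i)%g a)) r.
  have Xn i : X (i + n)%N = X i.
    have hk' w' : (v * (g * w' * g^-1) ^+ n * v^-1 * (v * g) = v * g * w' ^+ n)%g.
      by rewrite conj_expg !mulgA !mulgVK.
    rewrite /X -[RHS](cf_rep_notin hWS _ KS hk rK) -(repM hWS _ (v * g)%g) hk'.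
    by rewrite addnC expgnDr !(repM hWS).
  have Xrec i : X i.+2 = (c ^+ 2 - 2) * X i.+1 - X i.
    have := urec 1 0 i; rewrite scale1r scale0r addr0 => e'.
    by rewrite /X e' repB repZ cfB cfZ.
  rewrite /e; case: ifP => [/eqP c4'|c4'].
    have := periodic_rec_eq2 n0 Xn Xrec; rewrite /X expg1 expg0 (rep1 hWS).
    by rewrite repB cfB => ->; [rewrite subrr | rewrite c4'; ring].
  have := periodic_rec_gt2 n0 Xn Xrec; rewrite /X expg0 (rep1 hWS); apply.
  have : 4 < c ^+ 2 by rewrite lt_neqAle eq_sym c4' c4.
  by lra.
pose M x := forall g, gen_words A g -> inV K (rep (v * g)%g x).
have MD x y : M x -> M y -> M (x + y).
  by move=> hx hy g gA; rewrite repD; apply: inVD; [exact: hx | exact: hy].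
have MZ d x : M x -> M (d *: x) by move=> hx g gA; rewrite repZ; apply/inVZ/hx.
have MR s x : s \in J -> M x -> M (refl s x).
  move=> sJ hx g gA; rewrite -(repM_gen hWS); last exact: JS.
  rewrite -mulgA; apply: hx; apply: gen_wordsM => //.
  by apply: gen_words_gen; rewrite memA.
have [[s [sJ es]]|null'] := pselect (exists s, s \in J /\ pr e s != 0).
  move=> t tJ; have /(_ 1%g (gen_words1 _)) := stable_subspace MD MZ MR sJ hvKe es tJ.
  by rewrite mulg1.
have null s : s \in J -> pr e s = 0.
  by move=> sJ; apply/eqP; apply/negPn/negP => h; apply: null'; exists s.
have fixe g : gen_words A g -> rep g e = e.
  move=> [l lA <-]; rewrite (rep_word hWS); last by move=> t /lA/set_mem/AS/mem_set.
  elim: l lA => //= s l IH /words_cons[sA lA]; rewrite IH// /refl null ?scale0r ?subr0//.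
  by rewrite -memA.
(* A root has norm 2 and so is not orthogonal to [J]; only the case [c^2 = 4] remains. *)
have eE : e = rep u a - a.
  rewrite /e; case: ifP => // c4'; have := bil_root hWS uJ JS ra.
  have -> : bil a a = 0.
    by apply: bil_null => t tJ; have := null t tJ; rewrite /e c4'.
  by move/eqP; rewrite eq_sym pnatr_eq0.
have ua' : rep u a = a + e by move: eE => ->; rewrite addrC subrK.
have ui i : rep (u ^+ i)%g a = a + i%:R *: e.
  elim: i => [|i IH]; first by rewrite expg0 (rep1 hWS) scale0r addr0.
  rewrite (rep_expS hWS) IH repD repZ fixe// -natr1 scalerDl scale1r.
  by rewrite ua' -addrA [e + _]addrC.
(* All [a + i e] are roots; for large [i] mixed signs in [e] would show up in them. *)
have sgn : posv e \/ posv (- e).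
  apply: contrapT => nn.
  have [r1' h1] : exists r, cf e r < 0.
    apply: contrapT => h; apply: nn; left => r; rewrite leNgt.
    by apply/negP => h'; apply: h; exists r.
  have [r2' h2] : exists r, 0 < cf e r.
    apply: contrapT => h; apply: nn; right => r; rewrite cfN oppr_ge0 leNgt.
    by apply/negP => h'; apply: h; exists r.
  have [|k1 hk1] := @lt_natmul R (cf a r1') (- cf e r1'); first by rewrite oppr_gt0.
  have [k2 hk2] := @lt_natmul R (- cf a r2') (cf e r2') h2.
  pose k := maxn k1 k2; pose x := rep (u ^+ k)%g a.
  have rx : root_set S x.
    by apply/(rootsS AS)/roots_rep => //; exact: gen_wordsX.
  have cx r : cf x r = cf a r + k%:R * cf e r by rewrite /x ui cfD cfZ.
  have x1 : cf x r1' < 0.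
    rewrite cx -ltrBrDr sub0r -mulrN (lt_le_trans hk1)// ler_wpM2r ?oppr_ge0 ?(ltW h1)//.
    by rewrite ler_nat leq_maxl.
  have x2 : 0 < cf x r2'.
    rewrite cx -ltrBlDl sub0r (lt_le_trans hk2)// ler_wpM2r ?(ltW h2)//.
    by rewrite ler_nat leq_maxr.
  case: (roots_sign hWS rx) => px; first by have := px r1'; rewrite leNgt x1.
  by have := px r2'; rewrite cfN oppr_ge0 leNgt x2.
have [e' [he' pe' e0' null2 hvKe']] : exists e', [/\ inV A e', posv e', e' <> 0,
    (forall s, s \in J -> pr e' s = 0) & M e'].
  case: sgn => pe; first by exists e.
  exists (- e); split=> //; first exact: inVN.
  - by move=> h; apply: e0; rewrite -[e]opprK h oppr0.
  - by move=> s sJ; rewrite prN null// oppr0.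
  - by rewrite -scaleN1r; exact: MZ.
have full := null_vector_full_support he' pe' e0' null2.
have [g gA hg] := exists_min_coset v.
have hvg s : s \in J -> inV K (rep (v * g)%g (sroot s)).
  move=> sJ; apply: (inV_restrict (inV_root R hWS _ (JS sJ))) => r _ rK.
  have := inV_cf0 (hvKe' g gA) rK.
  rewrite (inV_seq uJ he') rep_sum cf_sum => /eqP; rewrite big_seq psumr_eq0.
    move=> /allP /(_ s sJ); rewrite sJ /= repZ cfZ mulf_eq0 gt_eqF ?full//=.
    by move/eqP.
  by move=> t tJ; rewrite repZ cfZ mulr_ge0// ?pe'//; exact: hg.
move=> s sJ; have -> : rep v (sroot s) = rep (v * g)%g (rep g^-1%g (sroot s)).
  by rewrite -(repM hWS) mulgK.
have hgs : inV A (rep g^-1%g (sroot s)).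
  by apply: (inV_rep hWS) => //; [exact: gen_wordsV | apply: inV_sroot; rewrite memA].
rewrite (inV_seq uJ hgs) rep_sum; apply: inV_sum => t tJ.
by rewrite repZ; apply/inVZ/hvg.
Qed.


Lemma fixing_simple_eq1 h : gen_words A h -> (forall s, s \in J -> rep h (sroot s) = sroot s) ->
  h = 1%g.
Proof.
move=> hA fixh; apply: (@parab_eq1 R _ _ hWS _ _ AS hA) => s; rewrite memA => sJ.
by rewrite fixh//; exact: posv_sroot.
Qed.

(** The action of [W_J] on this orbit is faithful: an element fixing it pointwise fixes a stable
    subspace that contains a vector not orthogonal to [J], hence fixes all simple roots of [J]. *)
Lemma adjacent_orbit_infinite s k : infinite_set (gen_words A) -> s \in S -> k \in J ->
  coxeter_edge S s k -> infinite_set [set rep g (sroot s) | g in gen_words A].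
Proof.
move=> infA sS kJ sk finO; apply: infA.
apply: (@finite_faithful _ _ _ _ (fun g x => rep g x) finO).
  move=> g x gA [h hA <-]; exists (g * h)%g; first exact: gen_wordsM.
  by rewrite (repM hWS).
move=> g h gA hA e; suff : (h^-1 * g)%g = 1%g by move=> /mulg1_eq; rewrite invgK.
apply: fixing_simple_eq1; first by apply: gen_wordsM => //; exact: gen_wordsV.
pose M x := forall g', gen_words A g' -> rep (h^-1 * g)%g (rep g' x) = rep g' x.
have MD x y : M x -> M y -> M (x + y).
  by move=> hx hy g' gA'; rewrite !repD hx// hy.
have MZ d x : M x -> M (d *: x) by move=> hx g' gA'; rewrite !repZ hx.
have MR r x : r \in J -> M x -> M (refl r x).
  move=> rJ hx g' gA'; rewrite -(repM_gen hWS); last exact: JS.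
  by apply: hx; apply: gen_wordsM => //; apply: gen_words_gen; rewrite memA.
have Ms : M (sroot s).
  move=> g' gA'; rewrite (repM hWS) e; last by exists g'.
  by rewrite (repK hWS).
move=> t tJ; have sk0 : pr (sroot s) k != 0.
  by rewrite pr_sroot lt_eqF// (cartan_edge _ sk).
have /(_ 1%g (gen_words1 _)) := stable_subspace MD MZ MR kJ Ms sk0 tJ.
by rewrite (rep1 hWS).
Qed.

(* A descent [s] of [v] outside [J] gives infinitely many inversions of [v] unless [s]
   commutes with [J]: all the roots of the [W_J]-orbit of [s] are inverted. *)
Lemma normalizer_letters K v : infinite_set (gen_words A) -> K `<=` S ->
  (forall s, s \in J -> inV K (rep v (sroot s))) ->
  (forall s, s \in K -> inV A (rep v^-1%g (sroot s))) ->
  forall p, p \in red_word S v -> p \notin J ->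
  forall s, s \in J -> ~~ coxeter_edge S p s.
Proof.
move=> infA KS; have infO := fun s k => @adjacent_orbit_infinite s k infA.
clear infA; have [lS lw lz] := red_wordP hWS v.
move: (red_word S v) lS lw lz => l; elim/last_ind: l v => // l s IH v lS lw lz hv hv'.
have [lS' sS] := words_rcons lS.
have vs : (v * s)%g = prodw l.
  by rewrite -lw prodw_rcons -mulgA (coxeter_invol hWS)// mulg1.
have ls : len v = (len (v * s)%g).+1.
  case: (len_prod_gen hWS v sS) => // e; have := len_le lS'.
  by rewrite -vs e -/len -lz size_rcons; lia.
have hKA x : inV K x -> inV A (rep v^-1%g x).
  apply: (inV_ind (P := fun x => inV A (rep v^-1%g x))) => [|y z hy hz|c y hy|r rK].
  - by rewrite rep0; exact: inV0.
  - by rewrite repD; exact: inVD.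
  - by rewrite repZ; exact: inVZ.
  - exact: hv'.
have hAK x : inV A x -> inV K (rep v x).
  apply: (inV_ind (P := fun x => inV K (rep v x))) => [|y z hy hz|c y hy|r].
  - by rewrite rep0; exact: inV0.
  - by rewrite repD; exact: inVD.
  - by rewrite repZ; exact: inVZ.
  - by rewrite memA => /hv.
have perp : s \notin J -> forall t, t \in J -> ~~ coxeter_edge S s t.
  move=> sJ t tJ; apply/negP => st.
  apply: (infO _ _ sS tJ st).
  have nvs := root_neg R hWS sS ls.
  (* Otherwise [v] would send the root of [s] into [V_K], and the root would be in [V_J]. *)
  have [r rK nr] : exists2 r, r \notin K & cf (rep v (sroot s)) r < 0.
    apply: contrapT => nex.
    have /hKA : inV K (rep v (sroot s)).
      apply: (inV_restrict (inV_root R hWS v sS)) => r _ rK; apply/eqP.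
      rewrite eq_le -[_ <= 0]oppr_ge0 -cfN nvs leNgt; apply/negP => h.
      by apply: nex; exists r.
    rewrite (repK hWS) => hs.
    have /eqP : cf (sroot s) s = 0 by apply: (inV_cf0 hs); rewrite memA.
    by rewrite cf_sroot eqxx oner_eq0.
  apply: sub_finite_set (finite_inversions R hWS v) => _ [g gA <-].
  have cg q : q \notin J -> cf (rep g (sroot s)) q = (q == s)%:R.
    by move=> qJ; rewrite (cf_rep_notin hWS _ AS gA) ?memA// cf_sroot.
  split; first exact: roots_all.
    case: (root_sign R hWS g sS) => // /(_ s).
    by rewrite cfN cg// eqxx oppr_ge0 ler10.
  rewrite -(repM hWS); case: (root_sign R hWS (v * g)%g sS) => // /(_ r).
  (* [v] maps this difference into [V_K], so the [r]-coordinate stays negative along the whole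
     orbit. *)
  have hd : inV A (rep g (sroot s) - sroot s).
    apply: (inV_restrict (A := A) (B := S)).
      by apply: inVB; [exact: inV_root | exact: inV_sroot].
    by move=> q _; rewrite memA => qJ; rewrite cfB cg// cf_sroot subrr.
  rewrite (repM hWS) -[rep g (sroot s)](subrK (sroot s)) repD cfD.
  by rewrite (inV_cf0 (hAK _ hd) rK) add0r leNgt nr.
(* Whether [s] is in [J] or orthogonal to it, [V_J] is stable, so the hypotheses pass to [v s]. *)
have reflA x : inV A x -> inV A (refl s x).
  have [sJ|sJ] := boolP (s \in J); first by apply: inV_refl; rewrite memA.
  move=> hx; rewrite /refl; suff -> : pr x s = 0 by rewrite scale0r subr0.
  rewrite (inV_seq uJ hx) pr_sum big_seq big1// => t tJ; rewrite prZ pr_sroot.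
  have ts : t != s by apply: contraNneq sJ => <-.
  rewrite (_ : cartan R t s = 0) ?mulr0//; apply/eqP.
  rewrite eq_le (cartan_le0 R hWS (JS tJ) sS ts) leNgt; apply/negP => ct.
  have /negP := perp sJ t tJ; apply; apply: (@cartan_lt0_edge R) => //; first exact: JS.
  by rewrite (cartan_sym R hWS)//; exact: JS.
have szl : size l = len (v * s)%g.
  by move: lz; rewrite -/len ls size_rcons => -[].
move=> p; rewrite mem_rcons in_cons => /orP[/eqP->|pl]; first exact: perp.
apply: (IH (v * s)%g) => //.
- move=> t tJ; rewrite (repM_gen hWS)//; apply/hAK/reflA.
  by apply: inV_sroot; rewrite memA.
- move=> t tK; rewrite invgM (invg_involution (coxeter_invol hWS) sS).
  by rewrite (repM hWS) (rep_gen hWS)//; apply/reflA/hv'.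
Qed.

End Normalizer.



(** * Fixed points of the automorphism *)

Section LongestElement.
Variables (R : realType) (W : groupType) (S : set W) (hWS : coxeter_system S).
Implicit Types (A B : set W) (s t w v g h : W) (l : seq W).
Local Notation V := (W * bool -> R^o).
Implicit Types (x y : V).
Local Notation sroot := (sroot R).
Local Notation rep := (rep S).
Local Notation len := (coxeter_length S).

Lemma finite_argmax (T : eqType) (P : set T) (f : T -> nat) : finite_set P -> P !=set0 ->
  exists2 x : T, P x & forall y : T, P y -> (f y <= f x)%N.
Proof.
move=> /finite_seqP[l ->] [z /= zl].
elim: l z zl => // a l IH _ _; case: l IH => [_|b l IH].
  by exists a => [|y /=]; rewrite /= ?mem_head// mem_seq1 => /eqP->.
have [x xl hx] := IH b (mem_head _ _).
have [fax|fxa] := leqP (f a) (f x).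
  exists x => [|y /=]; first by rewrite /= in_cons xl orbT.
  by rewrite in_cons => /orP[/eqP->|/hx].
exists a => [|y /=]; first by rewrite /= mem_head.
rewrite in_cons => /orP[/eqP->//|/hx]; by move=> h; rewrite (leq_trans h)// ltnW.
Qed.

Lemma pos_on_cone A w x : (forall s, s \in A -> posv (rep w (sroot s))) ->
  inV A x -> posv x -> posv (rep w x).
Proof.
move=> pos [l [_ lA e]] px; rewrite e rep_sum => t; rewrite cf_sum big_seq.
apply: sumr_ge0 => r /lA /pos h; rewrite repZ cfZ; exact: mulr_ge0.
Qed.

Lemma neg_on_cone A w x : (forall s, s \in A -> posv (- rep w (sroot s))) ->
  inV A x -> posv x -> posv (- rep w x).
Proof.
move=> neg [l [_ lA e]] px; rewrite e rep_sum -sumrN => t; rewrite cf_sum big_seq.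
apply: sumr_ge0 => r /lA /neg h; rewrite repZ -scalerN cfZ; exact: mulr_ge0.
Qed.

Lemma pos_ascent w s : s \in S -> posv (rep w (sroot s)) -> len (w * s)%g = (len w).+1.
Proof.
move=> sS pw; case: (len_prod_gen hWS w sS) => // e.
by case: (root_not_both hWS sS pw (root_neg R hWS sS e)).
Qed.

(** [w] keeps the positive roots of [A] positive, so a descent of [v] in [A] is also one of
    [w v]. *)
Lemma len_mul_parab A w v : A `<=` S -> (forall s, s \in A -> posv (rep w (sroot s))) ->
  gen_words A v -> len (w * v)%g = (len w + len v)%N.
Proof.
move=> AS pos; have [n] := ubnP (len v); elim: n v => // n IH v /ltnSE vn vA.
have [->|v1] := pselect (v = 1%g); first by rewrite mulg1 len1 addn0.
have [s sA ns] : exists2 s, s \in A & posv (- rep v (sroot s)).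
  apply: contrapT => nex; apply: v1; apply: (@parab_eq1 R _ _ hWS _ _ AS vA) => s sA.
  case: (root_sign R hWS v (mem_set (AS _ (set_mem sA)))) => // h.
  by case: nex; exists s.
have sS : s \in S by apply/mem_set/AS/set_mem.
have ev := neg_descent hWS sS ns.
have vsA : gen_words A (v * s)%g by apply: gen_wordsM => //; exact: gen_words_gen.
have IHv : len (w * (v * s))%g = (len w + len (v * s)%g)%N.
  by apply: IH => //; rewrite -ev.
have : posv (rep (w * (v * s))%g (sroot s)).
  rewrite (repM hWS); apply: (pos_on_cone (A := A)) => //.
    by apply: (inV_rep hWS) => //; exact: inV_sroot.
  by rewrite (repM_sroot _ hWS).
move=> /(pos_ascent sS); rewrite -!mulgA (coxeter_invol hWS)// mulg1 IHv => ->.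
by rewrite -addnS -ev.
Qed.

Section Longest.
Variables (A : set W) (AS : A `<=` S) (finA : finite_set (gen_words A)).

Let AI : involutive_set A.
Proof. by move=> s /set_mem/AS/mem_set/(coxeter_invol hWS). Qed.

Lemma longestP : gen_words A (longest S A) /\
  forall v, gen_words A v -> (len v <= len (longest S A))%N.
Proof.
rewrite /longest (subgroup_genE AI); case: xgetP => [w _ []//|no].
have [w wA hw] := finite_argmax len finA (ex_intro _ _ (gen_words1 A)).
by case: (no w).
Qed.

Lemma longest_neg_of_max w : gen_words A w -> (forall v, gen_words A v -> (len v <= len w)%N) ->
  forall s, s \in A -> posv (- rep w (sroot s)).
Proof.
move=> wA hw s sA; have sS : s \in S by apply/mem_set/AS/set_mem.
case: (root_sign R hWS w sS) => // /(pos_ascent sS) e.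
have := hw (w * s)%g; rewrite e ltnn => h; suff : false by [].
by apply: h; apply: gen_wordsM => //; exact: gen_words_gen.
Qed.

Lemma longest_neg s : s \in A -> posv (- rep (longest S A) (sroot s)).
Proof. by have [wA hw] := longestP; exact: longest_neg_of_max. Qed.

(** Elements of maximal length in [W_A] make all positive roots of [A] negative, so the quotient of
    two of them keeps these roots positive. *)
Lemma longest_uniq w : gen_words A w -> (forall v, gen_words A v -> (len v <= len w)%N) ->
  w = longest S A.
Proof.
move=> wA hw; have [w0A hw0] := longestP.
suff : ((longest S A)^-1 * w)%g = 1%g by move=> /mulg1_eq; rewrite invgK.
have iA : gen_words A (longest S A)^-1%g by exact: gen_wordsV.
apply: (@parab_eq1 R _ _ hWS _ _ AS); first exact: gen_wordsM.
move=> s sA; rewrite (repM hWS) -[rep w _]opprK repN.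
apply: (neg_on_cone (A := A)).
- apply: longest_neg_of_max => // v vA; rewrite (lenV hWS); exact: hw0.
- by apply/inVN/(inV_rep hWS) => //; exact: inV_sroot.
- exact: longest_neg_of_max.
Qed.

Lemma longestV : ((longest S A)^-1)%g = longest S A.
Proof.
have [w0A hw0] := longestP; apply: longest_uniq; first exact: gen_wordsV.
by move=> v vA; rewrite (lenV hWS); exact: hw0.
Qed.

End Longest.

(* If they commuted, [w_J] would fix the root of [s], although it sends the adjacent root
   of [t] to a negative one. *)
Lemma longest_not_commute A B s t : A `<=` S -> B `<=` S -> A `&` B = set0 ->
  finite_set (gen_words A) -> finite_set (gen_words B) ->
  s \in A -> t \in B -> coxeter_edge S s t ->
  (longest S A * longest S B)%g <> (longest S B * longest S A)%g.
Proof.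
move=> AS BS AB finA finB sA tB st comm.
have sS : s \in S by apply/mem_set/AS/set_mem.
have tS : t \in S by apply/mem_set/BS/set_mem.
have disj r : r \in A -> r \notin B.
  move=> rA; apply/negP => rB; have : (A `&` B) r by split; exact: set_mem.
  by rewrite AB.
have [wA _] := longestP AS finA; have [wB _] := longestP BS finB.
set a := longest S A in comm wA; set b := longest S B in comm wB.
have posB r : r \in A -> posv (rep b (sroot r)).
  move=> rA; have rS : r \in S by apply/mem_set/AS/set_mem.
  case: (root_sign R hWS b rS) => // /(_ r).
  by rewrite cfN (cf_rep_notin hWS _ BS wB (disj r rA)) cf_sroot eqxx oppr_ge0 ler10.
pose x := rep b (sroot s).
have nx : posv (- rep a x).
  rewrite /x -(repM hWS) comm (repM hWS) -repN; apply: (pos_on_cone (A := A)) => //.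
    by apply/inVN/(inV_rep hWS) => //; exact: inV_sroot.
  exact: (longest_neg AS finA).
(* [x] differs from the root of [s] only in coordinates of [B]. These are nonnegative in [x],
   unchanged by [a], and nonpositive in [rep a x]. *)
have xs : x = sroot s.
  apply: (inV_eq (inV_root R hWS b sS) (inV_sroot R sS)) => r.
  have [rB|rB] := boolP (r \in B); last by rewrite (cf_rep_notin hWS _ BS wB rB).
  have rA : r \notin A by apply/negP => /disj; rewrite rB.
  have rs : (r == s) = false by apply: contraNF rA => /eqP->.
  rewrite cf_sroot rs; apply/eqP; rewrite eq_le -/x (posB s sA) andbT.
  by have := nx r; rewrite cfN oppr_ge0 (cf_rep_notin hWS _ AS wA rA).
(* Now [(s, t) = (b s, t) = (s, b t)], and [b t] is a negative vector of [V_B], so the product is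
   nonnegative, against the edge. *)
have := pr_rep_sym R hWS b sS tS; rewrite -/x xs pr_sroot /b (longestV BS finB) -/b.
have hb : inV B (rep b (sroot t)) by apply: (inV_rep hWS) => //; exact: inV_sroot.
move=> e; have := cartan_edge R st; rewrite e ltNge -oppr_le0 -prN.
rewrite (pr_pos_le0 hWS BS sS (disj s sA) (inVN hb))//.
exact: (longest_neg BS finB).
Qed.

End LongestElement.



(** * Finite connected subgraphs of infinite type *)

Section SmallSubgraph.
Variables (R : realType) (W : groupType) (S : set W) (hWS : coxeter_system S).
Implicit Types (s t w : W) (J l : seq W).

Lemma coxeter_edge_sym s t : coxeter_edge S s t = coxeter_edge S t s.
Proof.
rewrite /coxeter_edge andbCA; case: (boolP (t \in S)) => //= tS.
case: (boolP (s \in S)) => //= sS; rewrite -gorderV invgM.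
by rewrite !(invg_involution (coxeter_invol hWS)).
Qed.

Lemma commute_of_no_edge s t : s \in S -> t \in S -> ~~ coxeter_edge S s t ->
  (s * t = t * s)%g.
Proof.
move=> sS tS; rewrite /coxeter_edge sS tS /= negb_or => /andP[n0 n3].
have [->//|st] := eqVneq s t.
have := expg_gorder (s * t)%g; have := gorder_neq1 hWS sS tS st.
case: gorder n0 n3 => [|[|[|n]]]// _ _ _; rewrite expg2 => /mulg1_eq <-.
by rewrite invgM !(invg_involution (coxeter_invol hWS)).
Qed.

Lemma exists_minimal_infinite J : infinite_set (gen_words [set` J]) ->
  exists J0, [/\ {subset J0 <= J}, infinite_set (gen_words [set` J0]) &
    forall J1, {subset J1 <= J0} -> (size J1 < size J0)%N ->
      finite_set (gen_words [set` J1])].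
Proof.
have [n] := ubnP (size J); elim: n J => // n IH J /ltnSE Jn infJ.
have [[J1 [J1J lt infJ1]]|nex] := pselect (exists J1, [/\ {subset J1 <= J},
    (size J1 < size J)%N & infinite_set (gen_words [set` J1])]).
  have [J0 [J0J1 inf0 min0]] := IH J1 (leq_trans lt Jn) infJ1.
  by exists J0; split; [move=> s /J0J1/J1J | |].
exists J; split; [by [] | exact: infJ |] => J1 J1J lt; apply: contrapT => inf1.
by apply: nex; exists J1; split.
Qed.

Lemma minimal_infinite_connected J : {subset J <= S} ->
  infinite_set (gen_words [set` J]) ->
  (forall J1, {subset J1 <= J} -> (size J1 < size J)%N ->
     finite_set (gen_words [set` J1])) ->
  coxeter_connected S J.
Proof.
move=> JS infJ min X [s sJ Xs] closed t tJ; apply: contrapT => nXt; apply: infJ.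
pose J1 := [seq r <- J | r \in X]; pose J2 := [seq r <- J | r \notin X].
have fin1 : finite_set (gen_words [set` J1]).
  apply: min => [r|]; first by rewrite mem_filter => /andP[].
  rewrite size_filter -(count_predC (mem X) J) -[ltnLHS]addn0 ltn_add2l -has_count.
  by apply/hasP; exists t => //=; apply/negP => /set_mem.
have fin2 : finite_set (gen_words [set` J2]).
  apply: min => [r|]; first by rewrite mem_filter => /andP[].
  rewrite size_filter -(count_predC (mem X) J) -[ltnLHS]add0n ltn_add2r -has_count.
  by apply/hasP; exists s => //=; exact: mem_set.
have comm r1 r2 : r1 \in J1 -> r2 \in J2 -> (r1 * r2 = r2 * r1)%g.
  rewrite !mem_filter => /andP[/set_mem X1 j1] /andP[X2 j2].
  apply: commute_of_no_edge; [exact: JS | exact: JS |].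
  apply/negP => e; case/negP: X2; apply/mem_set; exact: closed e.
apply: sub_finite_set (finite_image2 (fun x y => (x * y)%g) fin1 fin2).
move=> _ [l lJ <-]; elim: l lJ => [|r l IH] lJ.
  exists 1%g; first exact: gen_words1.
  by exists 1%g; [exact: gen_words1 | rewrite prodw_nil mulg1].
have [rJ {}lJ] := words_cons lJ; rewrite mem_setE in rJ.
have [x xJ [y yJ e]] := IH lJ; rewrite prodw_cons -e.
have [rX|rX] := boolP (r \in X).
  exists (r * x)%g; last by exists y; rewrite ?mulgA.
  by apply: gen_wordsM => //; apply: gen_words_gen; rewrite mem_setE mem_filter rX.
exists x => //; exists (r * y)%g.
  by apply: gen_wordsM => //; apply: gen_words_gen; rewrite mem_setE mem_filter rX.
rewrite !mulgA; congr (_ * _)%g; case: xJ => l1 l1J <-.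
elim: l1 l1J => [|r1 l1 IH1]; first by rewrite prodw_nil mulg1 mul1g.
move=> /words_cons[r1J /IH1 e1]; rewrite mem_setE in r1J.
by rewrite prodw_cons -mulgA e1 !mulgA (comm r1 r)// mem_filter rX.
Qed.

(** The vertices of the path are added to [J] until the next one is [p]. *)
Lemma connected_up_to J s p q : {subset J <= S} -> coxeter_connected S J -> s \in J ->
  p \notin J -> path (coxeter_edge S) s q -> last s q = p ->
  exists J', [/\ {subset J <= J'}, {subset J' <= S}, coxeter_connected S J', p \notin J' &
    exists2 k, k \in J' & coxeter_edge S k p].
Proof.
elim: q J s => [|r q IH] J s JS conn sJ pJ /=; first by move=> _ e; rewrite -e sJ in pJ.
move=> /andP[sr pq] e; have [rp|rp] := eqVneq r p.
  by exists J; split=> //; exists s => //; rewrite -rp.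
have rS : r \in S by case/and3P: sr.
have [|||J' [J1J' J'S conn' pJ' ex]] := IH (r :: J) r _ _ (mem_head _ _) _ pq e.
- by move=> z; rewrite in_cons => /orP[/eqP->|/JS].
- move=> X [z zJ Xz] closed.
  have Xs : X s.
    have [z' z'J Xz'] : exists2 z', z' \in J & X z'.
      move: zJ; rewrite in_cons => /orP[/eqP zr|zJ]; last by exists z.
      exists s => //; apply: (closed r); rewrite ?mem_head ?in_cons ?sJ ?orbT//.
        by rewrite -zr.
      by rewrite coxeter_edge_sym.
    apply: (conn X) sJ; first by exists z'.
    by move=> a b aJ bJ; apply: closed; rewrite in_cons ?aJ ?bJ orbT.
  move=> a; rewrite in_cons => /orP[/eqP->|aJ].
    by apply: (closed s) => //; rewrite ?mem_head// in_cons sJ orbT.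
  apply: (conn X) aJ; first by exists s.
  by move=> c b cJ bJ; apply: closed; rewrite in_cons ?cJ ?bJ orbT.
- by rewrite in_cons negb_or eq_sym rp.
by exists J'; split=> // z zJ; apply: J1J'; rewrite in_cons zJ orbT.
Qed.

End SmallSubgraph.

(** * The automorphism, its orbits and its fixed elements *)

Section Automorphism.
Variables (R : realType) (W : groupType) (S : set W) (hWS : coxeter_system S).
Variables (tau : W -> W) (htau : coxeter_graph_aut S tau).
Variables (T : W -> W) (hauto : group_aut T) (hext : {in S, T =1 tau}).
Implicit Types (s t w : W) (l : seq W) (I : set W).
Local Notation V := (W * bool -> R^o).
Implicit Types (x y : V).
Local Notation sroot := (sroot R).
Local Notation rep := (rep S).
Local Notation len := (coxeter_length S).

Lemma autM w w' : T (w * w')%g = (T w * T w')%g. Proof. by case: hauto => _ ->. Qed.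

Lemma aut_inj : injective T. Proof. by case: hauto => /bij_inj. Qed.

Lemma aut1 : T 1%g = 1%g.
Proof. by apply: (mulgI (T 1%g)); rewrite -autM !mulg1. Qed.

Lemma autX w n : T (w ^+ n)%g = (T w ^+ n)%g.
Proof. by elim: n => [|n IH]; rewrite ?expg0 ?aut1// !expgS autM IH. Qed.

Lemma aut_prodw l : T (prodw l) = prodw (map T l).
Proof. by elim: l => [|s l IH]; rewrite ?prodw_nil ?aut1//= !prodw_cons autM IH. Qed.

Lemma aut_gen s : s \in S -> T s \in S.
Proof.
move=> sS; rewrite hext//; case: htau => [[fS _ _] _ _].
by apply/mem_set/fS/set_mem.
Qed.

Lemma aut_gen_surj t : t \in S -> exists2 s, s \in S & T s = t.
Proof.
case: htau => [[_ _ surj] _ _] /set_mem/surj[s /mem_set sS <-].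
by exists s => //; exact: hext.
Qed.

Lemma aut_edge s t : s \in S -> t \in S -> coxeter_edge S (T s) (T t) = coxeter_edge S s t.
Proof. by move=> sS tS; case: htau => _ h _; rewrite !hext// h. Qed.

Lemma gen_words_aut (A B : set W) w : (forall s, s \in A -> T s \in B) ->
  gen_words A w -> gen_words B (T w).
Proof.
move=> AB [l lA <-]; exists (map T l); last by rewrite aut_prodw.
by move=> z /mapP[s /lA /AB h ->].
Qed.

Lemma len_aut w : len (T w) = len w.
Proof.
apply/eqP; rewrite eqn_leq; apply/andP; split.
  have [lS lw lz] := red_wordP hWS w.
  rewrite -lz -{1}lw aut_prodw -(size_map T); apply: len_le.
  by move=> z /mapP[s /lS /aut_gen h ->].
have [lS lw lz] := red_wordP hWS (T w).
have [l' lS' el] : exists2 l', {subset l' <= S} & map T l' = red_word S (T w).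
  elim: (red_word S (T w)) lS => [|s l IH]; first by exists [::].
  move=> /words_cons[/aut_gen_surj[t tS <-] /IH[l' lS' <-]].
  by exists (t :: l') => // z; rewrite in_cons => /orP[/eqP->|/lS'].
have e : prodw l' = w by apply: aut_inj; rewrite aut_prodw el.
by rewrite -{1}e -lz -el size_map; exact: len_le.
Qed.

Definition autorbit s t := exists k : nat, t = iter k T s \/ s = iter k T t.

Lemma iter_aut_gen k s : s \in S -> iter k T s \in S.
Proof. by move=> sS; elim: k => //= k; exact: aut_gen. Qed.

Lemma iter_tau k s : s \in S -> iter k tau s = iter k T s.
Proof. by move=> sS; elim: k => //= k ->; rewrite hext//; exact: iter_aut_gen. Qed.

Lemma orbit_ofE s t : s \in S -> orbit_of S tau s t <-> t \in S /\ autorbit s t.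
Proof.
move=> sS; split=> [[/mem_set tS [k h]]|[tS [k h]]].
  by split=> //; exists k; rewrite -!iter_tau.
by split; [exact: set_mem | exists k; rewrite !iter_tau].
Qed.

Lemma autorbit_refl s : autorbit s s. Proof. by exists 0%N; left. Qed.

Lemma autorbit_sym s t : autorbit s t -> autorbit t s.
Proof. by move=> [k [h|h]]; exists k; [right | left]. Qed.

Lemma iter_aut_inj k : injective (iter k T).
Proof. by elim: k => [|k IH] x y //= /aut_inj/IH. Qed.

Lemma autorbit_trans s t r : autorbit s t -> autorbit t r -> autorbit s r.
Proof.
move=> [i [->|->]] [j [e|e]].
- by exists (j + i)%N; left; rewrite e iterD.
- have [ij|/ltnW ji] := leqP i j.
    exists (j - i)%N; right; apply: (@iter_aut_inj i).
    by rewrite -iterD subnKC.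
  exists (i - j)%N; left; apply: (@iter_aut_inj j).
  by rewrite -iterD subnKC.
- have [ij|/ltnW ji] := leqP i j.
    by exists (j - i)%N; left; rewrite e -iterD subnK.
  by exists (i - j)%N; right; rewrite e -iterD subnK.
- by exists (i + j)%N; right; rewrite e iterD.
Qed.

Lemma orbit_sub s : s \in S -> orbit_of S tau s `<=` S.
Proof. by move=> sS t []. Qed.

Lemma orbit_eq s t : s \in S -> t \in S -> autorbit s t ->
  orbit_of S tau s = orbit_of S tau t.
Proof.
move=> sS tS st; apply/seteqP; split=> r /orbit_ofE.
  move=> /(_ sS)[rS sr]; apply/orbit_ofE => //; split=> //.
  exact: autorbit_trans (autorbit_sym st) sr.
move=> /(_ tS)[rS tr]; apply/orbit_ofE => //; split=> //.
exact: autorbit_trans st tr.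
Qed.

Lemma orbit_mem s : s \in S -> s \in orbit_of S tau s.
Proof. by move=> sS; apply/mem_set/orbit_ofE => //; split=> //; exact: autorbit_refl. Qed.

Lemma orbit_aut s t : s \in S -> t \in orbit_of S tau s -> T t \in orbit_of S tau s.
Proof.
move=> sS /set_mem/orbit_ofE => /(_ sS)[tS st]; apply/mem_set/orbit_ofE => //.
by split; [exact: aut_gen | apply: autorbit_trans st _; exists 1%N; left].
Qed.

(** [T (w * t) = w * T t] for fixed [w], and [T] preserves length; hence descents of [w] form unions
    of orbits. *)
Lemma len_mul_orbit w s t : T w = w -> autorbit s t -> len (w * t)%g = len (w * s)%g.
Proof.
move=> Tw; have key k r : len (w * iter k T r)%g = len (w * r)%g.
  by elim: k => //= k IH; rewrite -{1}Tw -autM len_aut IH.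
by move=> [k [->|->]]; rewrite key.
Qed.

Lemma neg_orbit w s t : T w = w -> s \in S -> t \in S -> autorbit s t ->
  posv (- rep w (sroot s)) -> posv (- rep w (sroot t)).
Proof.
move=> Tw sS tS st /(neg_descent hWS sS) e.
by apply: (root_neg R hWS tS); rewrite (len_mul_orbit Tw st).
Qed.

Lemma pos_orbit w s t : T w = w -> s \in S -> t \in S -> autorbit s t ->
  posv (rep w (sroot s)) -> posv (rep w (sroot t)).
Proof.
move=> Tw sS tS st /(pos_ascent hWS sS) e.
by apply: (root_pos R hWS tS); rewrite (len_mul_orbit Tw st).
Qed.

(** A nontrivial fixed element of [W_I] has a descent in [I], so all of [I] are descents and [W_I]
    is finite. *)
Lemma fixed_in_infinite_orbit s w : s \in S -> infinite_set (gen_words (orbit_of S tau s)) ->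
  T w = w -> gen_words (orbit_of S tau s) w -> w = 1%g.
Proof.
move=> sS infI Tw wI; apply: contrapT => w1; apply: infI.
have IS := orbit_sub sS.
have [t tI nt] : exists2 t, t \in orbit_of S tau s & posv (- rep w (sroot t)).
  apply: contrapT => nex; apply: w1; apply: (@parab_eq1 R _ _ hWS _ _ IS wI) => t tI.
  case: (root_sign R hWS w (mem_set (IS _ (set_mem tI)))) => // h.
  by case: nex; exists t.
apply: (@finite_parab R _ _ hWS _ w IS) => r rI.
have [tS st] := (orbit_ofE t sS).1 (set_mem tI).
have [rS sr] := (orbit_ofE r sS).1 (set_mem rI).
apply: (neg_orbit Tw tS rS _ nt); exact: autorbit_trans (autorbit_sym st) sr.
Qed.

Section FiniteOrbit.
Variables (s : W) (sS : s \in S).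
Hypothesis finI : finite_set (gen_words (orbit_of S tau s)).

Lemma longest_orbit_fixed : T (longest S (orbit_of S tau s)) = longest S (orbit_of S tau s).
Proof.
have IS := orbit_sub sS; have [wI hw] := longestP hWS IS finI.
apply: (@longest_uniq R _ _ hWS _ IS finI).
  by apply: gen_words_aut wI => t; exact: orbit_aut.
by move=> v vI; rewrite len_aut; exact: hw.
Qed.

Lemma longest_orbit_neq1 : longest S (orbit_of S tau s) <> 1%g.
Proof.
move=> e; have := longest_neg R hWS (orbit_sub sS) finI (orbit_mem sS).
rewrite e (rep1 hWS) => /(_ s); rewrite cfN cf_sroot eqxx.
by rewrite oppr_ge0 ler10.
Qed.

End FiniteOrbit.

Lemma infinite_fixed_points : infinite_set [set: W] ->
  (forall s, s \in S -> finite_set (gen_words (orbit_of S tau s))) ->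
  infinite_set [set w | T w = w].
Proof.
move=> infW finO finT; have [|w /= Tw hw] := finite_argmax len finT; first by exists 1%g; exact: aut1.
have [[s [sS ps]]|nex] := pselect (exists s, s \in S /\ posv (rep w (sroot s))); last first.
  apply: infW; apply: sub_finite_set (@finite_parab R _ _ hWS S w _ _) => //.
    by move=> v _; exact: coxeter_words.
  move=> s sS; case: (root_sign R hWS w sS) => // h; case: nex; by exists s.
have IS := orbit_sub sS; have [vI _] := longestP hWS IS (finO s sS).
have posI t : t \in orbit_of S tau s -> posv (rep w (sroot t)).
  move=> /set_mem/orbit_ofE => /(_ sS)[tS st]; exact: (pos_orbit Tw sS tS st ps).
have := hw (w * longest S (orbit_of S tau s))%g.
rewrite (len_mul_parab hWS IS posI vI) autM Tw (longest_orbit_fixed sS (finO s sS)).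
move=> /(_ erefl); rewrite -[leqRHS]addn0 leq_add2l leqn0 => /eqP /(len_eq0 hWS).
exact: (longest_orbit_neq1 sS (finO s sS)).
Qed.

(** Longest elements are involutions, so a product of order 1 or 2 would make them commute. *)
Lemma fixed_gens_edge s t : s \in S -> t \in S -> coxeter_edge S s t -> ~ autorbit s t ->
  finite_set (gen_words (orbit_of S tau s)) -> finite_set (gen_words (orbit_of S tau t)) ->
  longest S (orbit_of S tau s) \in fixed_gens S tau ->
  longest S (orbit_of S tau t) \in fixed_gens S tau ->
  coxeter_edge (fixed_gens S tau) (longest S (orbit_of S tau s)) (longest S (orbit_of S tau t)).
Proof.
move=> sS tS st nst finI finJ Is It; rewrite /coxeter_edge Is It /=.
have IS := orbit_sub sS; have JS := orbit_sub tS.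
have dis : orbit_of S tau s `&` orbit_of S tau t = set0.
  rewrite -subset0 => r [/(orbit_ofE r sS)[rS sr] /(orbit_ofE r tS)[_ tr]]; apply: nst.
  exact: autorbit_trans sr (autorbit_sym tr).
have := @longest_not_commute R _ _ hWS _ _ _ _ IS JS dis finI finJ (orbit_mem sS) (orbit_mem tS) st.
have vI := @longestV R _ _ hWS _ IS finI; have vJ := @longestV R _ _ hWS _ JS finJ.
move: (longest S _) (longest S _) vI vJ => b a va vb nc.
have := expg_gorder (a * b)%g; case: gorder => [|[|[|n]]]//.
  by rewrite expg1 => /mulg1_eq e; case: nc; rewrite -e va.
rewrite expg2 => /mulg1_eq; rewrite invgM va vb => e; by case: nc.
Qed.

Lemma fixed_gens_irreducible : coxeter_irreducible S ->
  (forall s, s \in S -> finite_set (gen_words (orbit_of S tau s))) ->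
  coxeter_irreducible (fixed_gens S tau).
Proof.
move=> hirr finO a b /set_mem[_ [[s /mem_set sS <-] _] <-] /set_mem[_ [[t /mem_set tS <-] _] <-].
have mem r : r \in S -> longest S (orbit_of S tau r) \in fixed_gens S tau.
  move=> rS; apply/mem_set; exists (orbit_of S tau r) => //; split.
    by exists r => //; exact: set_mem.
  rewrite subgroup_genE; first exact: finO.
  by move=> z /set_mem/(orbit_sub rS)/mem_set/(coxeter_invol hWS).
have [q [pq <-]] := hirr s t sS tS; elim: q s sS pq => [|r q IH] s sS /=; first by exists [::].
move=> /andP[sr pq]; have rS : r \in S by case/and3P: sr.
have [q' [pq' lq']] := IH r rS pq; rewrite -lq'.
(* Neighbours in one orbit give the same generator, and the path makes no step. *)
have [asr|nsr] := pselect (autorbit s r).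
  by exists q'; rewrite (orbit_eq sS rS asr).
exists (longest S (orbit_of S tau r) :: q') => /=; split=> //; rewrite pq' andbT.
exact: (fixed_gens_edge sS rS sr nsr (finO _ sS) (finO _ rS) (mem _ sS) (mem _ rS)).
Qed.

Lemma connected_aut J : {subset J <= S} -> coxeter_connected S J ->
  coxeter_connected S (map T J).
Proof.
move=> JS conn X [_ /mapP[s sJ ->] Xs] closed _ /mapP[t tJ ->].
apply: (conn (fun r => X (T r))) tJ; first by exists s.
move=> a b aJ bJ Xa ab; apply: (closed (T a)); rewrite ?map_f//.
by rewrite aut_edge//; exact: JS.
Qed.

Lemma gen_words_map_aut J w : gen_words [set` map T J] w ->
  exists2 v, gen_words [set` J] v & T v = w.
Proof.
move=> [l lJ <-]; elim: l lJ => [|s l IH].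
  by exists 1%g; [exact: gen_words1 | rewrite aut1 prodw_nil].
move=> /words_cons[+ /IH[v vJ e]]; rewrite mem_setE => /mapP[t tJ ->].
exists (t * v)%g; last by rewrite autM e prodw_cons.
by apply: gen_wordsM => //; apply: gen_words_gen; rewrite mem_setE.
Qed.

(** Excluding positive [n] suffices: it gives the infinite order of [u] and, by inversion, the
    negative exponents. *)
Lemma twisted_power (w : W) : coxeter_irreducible S -> T w = w -> w <> 1%g ->
  (exists s, [/\ s \in S, finite_set (orbit_of S tau s) &
     infinite_set (gen_words (orbit_of S tau s))]) ->
  exists u, forall n, (0 < n)%N -> (w^-1 * u ^+ n * w)%g <> T (u ^+ n)%g.
Proof.
move=> hirr Tw w1 [s [sS fI infI]]; apply: contrapT => nex.
have hu u : exists2 n, (0 < n)%N & (w^-1 * u ^+ n * w)%g = T (u ^+ n)%g.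
  apply: contrapT => h; apply: nex; exists u => n n0 e; apply: h; by exists n.
have IS := orbit_sub sS.
have AI (A : set W) : A `<=` S -> involutive_set A.
  by move=> AS z /set_mem/AS/mem_set/(coxeter_invol hWS).
have [vS vw vz] := red_wordP hWS (w^-1)%g.
have [p pv pI] : exists2 p, p \in red_word S (w^-1)%g & p \notin orbit_of S tau s.
  apply: contrapT => np; apply: w1; apply: (fixed_in_infinite_orbit sS infI Tw).
  rewrite -[w]invgK; apply: gen_wordsV; first exact: AI.
  exists (red_word S (w^-1)%g); last exact: vw.
  move=> z zv; apply: contrapT => /negP zI.
  by apply: np; exists z.
have pS := vS p pv.
have /finite_seqP[I eI] := fI; rewrite eI in infI.
have [J0 [J0I inf0 min0]] := exists_minimal_infinite infI.
have J0S : {subset J0 <= S}.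
  by move=> z /J0I zI; apply/mem_set/IS; rewrite eI.
have conn0 := minimal_infinite_connected hWS J0S inf0 min0.
have pJ0 : p \notin J0.
  by apply: contra pI => /J0I pI'; apply/mem_set; rewrite eI.
have [j0 j0J] : exists j0, j0 \in J0.
  case: (J0) inf0 => [inf|j0 J]; last by exists j0; rewrite mem_head.
  case: inf; apply: (@sub_finite_set _ _ [set 1%g]); last exact: finite_set1.
  move=> _ [[|z l0] l0A <-]; first by rewrite prodw_nil.
  by have := l0A z (mem_head _ _); rewrite mem_setE.
have [q [pq lq]] := hirr j0 p (J0S _ j0J) pS.
have [J' [J0J' J'S conn' pJ' [k kJ' kp]]] := connected_up_to hWS J0S conn0 j0J pJ0 pq lq.
pose J := undup J'; have memJ z : (z \in J) = (z \in J') by rewrite mem_undup.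
have JS : {subset J <= S} by move=> z; rewrite memJ => /J'S.
have conn : coxeter_connected S J.
  move=> X [z]; rewrite memJ => zJ Xz closed r; rewrite memJ; apply: (conn' X).
    by exists z.
  by move=> a b aJ bJ; apply: closed; rewrite memJ.
have infJ : infinite_set (gen_words [set` J]).
  apply: sub_infinite_set inf0 => z; apply: gen_wordsS => r /= /J0J'.
  by rewrite memJ.
have uJ : uniq J by exact: undup_uniq.
have uTJ : uniq (map T J) by rewrite (map_inj_uniq aut_inj).
have TJS : {subset map T J <= S} by move=> z /mapP[r /JS/aut_gen h ->].
have setS (l : seq W) : {subset l <= S} -> [set` l] `<=` S.
  by move=> lS z /= /lS /set_mem.
have infTJ : infinite_set (gen_words [set` map T J]).
  move=> fin; apply: infJ; apply: (@sub_finite_set _ _ (T @^-1` gen_words [set` map T J])).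
    by move=> z; apply: gen_words_aut => r; rewrite !mem_setE; exact: map_f.
  by apply: finite_preimage fin => a b _ _; exact: aut_inj.
have h1 : forall z, z \in J -> inV [set` map T J] (rep w^-1%g (sroot z)).
  apply: (@power_conj_subspace R _ _ hWS _ uJ JS conn _ w^-1%g infJ (setS _ TJS)) => u uJ'.
  have [n n0 e] := hu u; exists n; [exact: n0 | rewrite invgK e].
  apply: (@gen_words_aut [set` J]); last exact: gen_wordsX.
  by move=> r; rewrite !mem_setE; exact: map_f.
have h2 : forall z, z \in map T J -> inV [set` J] (rep w (sroot z)).
  (* The same assumption on powers, read backwards for [w] and [T J]; both inclusions are needed by
     [normalizer_letters]. *)
  apply: (@power_conj_subspace R _ _ hWS _ uTJ TJS (connected_aut JS conn) _ w infTJ (setS _ JS)).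
  move=> _ /gen_words_map_aut[u uJ' <-]; have [n n0 e] := hu u; exists n; first exact: n0.
  by rewrite -autX -e !mulgA mulgV mul1g mulgK; exact: gen_wordsX.
have h3 z : z \in [set` map T J] -> inV [set` J] (rep (w^-1)^-1%g (sroot z)).
  by rewrite mem_setE invgK; exact: h2.
have pJ : p \notin J by rewrite memJ.
have kJ : k \in J by rewrite memJ.
have := normalizer_letters hWS uJ JS conn infJ (setS _ TJS) h1 h3 pv pJ kJ.
by rewrite (coxeter_edge_sym hWS p k) kp.
Qed.

End Automorphism.

(** * The theorem, with the representation taken over a concrete real field *)

Import Rstruct.

Local Open Scope group_scope.

Theorem theorem5p2 (W : groupType) (S : set W)
    (hWS : coxeter_system S)
    (hinf : infinite_set [set: W])
    (hirr : coxeter_irreducible S)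
    (tau : W -> W) (htau : coxeter_graph_aut S tau)
    (* the extension of tau to a group automorphism of W *)
    (tauW : W -> W) (hauto : group_aut tauW)
    (hext : {in S, tauW =1 tau}) :
  ((forall I, orbits S tau I -> finite_set (subgroup_gen I)) ->
     infinite_set (fixed_points tauW) /\
     coxeter_irreducible (fixed_gens S tau))
  /\
  ((exists I, orbits S tau I /\ infinite_set (subgroup_gen I)) ->
   (forall I, orbits S tau I -> finite_set I) ->
   forall w, w <> 1 -> fixed_points tauW w ->
   exists u : W, gorder u = 0%N /\
     forall k : int, k <> Posz 0 ->
       expgz u k * w * expgz (tauW u) (- k)%R <> w).
Proof.
have genE s : s \in S -> subgroup_gen (orbit_of S tau s) = gen_words (orbit_of S tau s).
  move=> sS; apply: subgroup_genE => z /set_mem[zS _].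
  exact: (coxeter_invol hWS (mem_set zS)).
split=> [fin|[_ [[s /mem_set sS <-] inf]] finI w w1 Tw].
  have finO s : s \in S -> finite_set (gen_words (orbit_of S tau s)).
    by move=> sS; rewrite -genE//; apply: fin; exists s => //; exact: set_mem.
  split; first exact: (infinite_fixed_points Rdefinitions.R hWS htau hauto hext).
  exact: (fixed_gens_irreducible Rdefinitions.R hWS htau hauto hext).
have [|u hu] := twisted_power Rdefinitions.R hWS htau hauto hext hirr Tw w1.
  exists s; split=> //; last by rewrite -genE.
  by apply: finI; exists s => //; exact: set_mem.
have TX := autX hauto u; exists u; split.
  (* If [u] had finite order [n > 0], both sides of the excluded relation would be 1. *)
  apply/eqP; rewrite -leqn0 leqNgt; apply/negP => /hu; apply.
  by rewrite expg_gorder mulg1 mulVg (aut1 hauto).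
have twist n : u ^+ n.+1 * w = w * tauW (u ^+ n.+1) -> False.
  by move=> e; apply: (hu n.+1) => //; rewrite -mulgA e mulKg.
case=> [[|n]|n] k0 //; last first.
  rewrite NegzE opprK -NegzE /= -TX => e; apply: (twist n).
  by rewrite -{1}e !mulgA mulgV mul1g.
by rewrite -NegzE /= -TX => e; apply: (twist n); rewrite -{2}e mulgVK.
Qed.
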